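(* Let $(R,\mathfrak{m})$ be a commutative Noetherian local ring and let $M$ be a finitely generated $R$-module which is locally free on the punctured spectrum of $R$. If $\operatorname{pd}_R(M)\leq \operatorname{depth}(R)/2$, then $\operatorname{pd}_R(M\otimes_R M)<\infty$.
   Context: $\operatorname{pd}_R$ denotes projective dimension, with $\operatorname{pd}_R(0)=-\infty$. $M$ is locally free on the punctured spectrum if $M_{\mathfrak{p}}$ is a free $R_{\mathfrak{p}}$-module for every prime ideal $\mathfrak{p}\neq\mathfrak{m}$ of $R$. *)

(* Defs.v *)
From HB Require Import structures.
From mathcomp Require Import all_boot all_order all_algebra.
From mathcomp Require Import boolp classical_sets constructive_ereal ereal.
From mathcomp Require Import ring.

Set Implicit Arguments.
Unset Strict Implicit.
Unset Printing Implicit Defensive.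

Import Order.TTheory GRing.Theory Num.Theory.

Local Open Scope ring_scope.
Local Open Scope quotient_scope.
Local Open Scope classical_set_scope.

Section Modules.
Variable A : pzRingType.

Definition in_span (V : lmodType A) (s : seq V) (x : V) : Prop :=
  exists c : nat -> A, x = \sum_(i < size s) c i *: s`_i.

Definition finitely_generated (V : lmodType A) : Prop :=
  exists s : seq V, forall x, in_span s x.

Definition is_basis (V : lmodType A) (B : set V) : Prop :=
  (forall x, exists2 s : seq V, [set` s] `<=` B & in_span s x) /\
  (forall s : seq V, uniq s -> [set` s] `<=` B ->
     forall c : V -> A, \sum_(v <- s) c v *: v = 0 ->
     forall v, v \in s -> c v = 0).

Definition free_module (V : lmodType A) : Prop :=
  exists B : set V, is_basis B.

Definition projective (P : lmodType A) : Prop :=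
  forall (V W : lmodType A) (g : {linear V -> W}) (f : {linear P -> W}),
    range g = setT ->
    exists h : {linear P -> V}, forall x, g (h x) = f x.

Definition zero_module (V : lmodType A) : Prop := forall x : V, x = 0.

(* ... -> P 2 -> P 1 -> P 0 -> V -> 0 is exact with all P i projective and    *)
(* P i = 0 for i > n.                                                         *)
Definition has_projective_resolution (V : lmodType A) (n : nat) : Prop :=
  exists (P : nat -> lmodType A)
         (d : forall i, {linear P i.+1 -> P i}) (e : {linear P 0 -> V}),
  [/\ (forall i, projective (P i)) /\
      (forall i, (n < i)%N -> zero_module (P i)),
      range e = setT,
      (forall x, e x = 0 <-> range (d 0) x) &
      (forall i x, d i x = 0 <-> range (d i.+1) x)].

(* The infimum is +oo when V has no projective resolution of finite length.   *)
Definition pd (V : lmodType A) : \bar rat :=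
  if `[< zero_module V >] then -oo%E
  else ereal_inf [set (n%:R : rat)%:E | n in has_projective_resolution V].

End Modules.

Section Rings.
Variable R : comNzRingType.

(* The structure idealr consists of the proper ideals; the improper ideal R   *)
(* is generated by 1.                                                         *)
Definition noetherian : Prop :=
  forall I : idealr R, exists s : seq R,
    forall x : R, x \in I <-> in_span (V := R^o) s x.

Definition maximal_ideal (I : idealr R) : Prop :=
  forall J : idealr R, {subset I <= J} -> J =i I.

Definition is_local (m : idealr R) : Prop :=
  maximal_ideal m /\ forall I : idealr R, maximal_ideal I -> I =i m.

(* Each rs`_i is a nonzerodivisor on R / (rs`_0, ..., rs`_(i-1)), and         *)
(* R / (rs) <> 0.                                                             *)
Definition regular_sequence (rs : seq R) : Prop :=
  (forall i, (i < size rs)%N -> forall a : R,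
     in_span (V := R^o) (take i rs) (rs`_i * a) ->
     in_span (V := R^o) (take i rs) a) /\
  ~ in_span (V := R^o) rs 1.

(* In a Noetherian local ring the lengths of the regular sequences in m are   *)
(* bounded, so this supremum is attained; the value 0 that supremum gives to  *)
(* an unbounded set plays no role.                                            *)
Definition depth (m : idealr R) : nat :=
  supremum 0%N
    [set size rs | rs in [set rs : seq R | {subset rs <= m} /\
                                           regular_sequence rs]].

End Rings.

(* The tensor product M (x)_R N: finite formal sums of pairs (x, y), encoded  *)
(* as sequences, modulo the congruence generated by the commutativity of the  *)
(* sum and the bilinearity of (x, y).                                         *)
Section Tensor.
Variables (R : comNzRingType) (M N : lmodType R).

Inductive tensor_eq : seq (M * N) -> seq (M * N) -> Prop :=
| tensor_eq_refl s : tensor_eq s s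
| tensor_eq_sym s t : tensor_eq s t -> tensor_eq t s
| tensor_eq_trans s t u : tensor_eq s t -> tensor_eq t u -> tensor_eq s u
| tensor_eq_cat s s' t t' :
    tensor_eq s s' -> tensor_eq t t' -> tensor_eq (s ++ t) (s' ++ t')
| tensor_eq_catC s t : tensor_eq (s ++ t) (t ++ s)
| tensor_eq_0l y : tensor_eq [:: (0, y)] [::]
| tensor_eq_Dl x x' y : tensor_eq [:: (x + x', y)] [:: (x, y); (x', y)]
| tensor_eq_Dr x y y' : tensor_eq [:: (x, y + y')] [:: (x, y); (x, y')]
| tensor_eq_Z a x y : tensor_eq [:: (a *: x, y)] [:: (x, a *: y)].

Definition tensor_eqb (s t : seq (M * N)) : bool := `[< tensor_eq s t >].

Lemma tensor_eqb_equiv : equiv_class_of tensor_eqb.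
Proof.
split=> [s|s t|t s u]; first exact/asboolP/tensor_eq_refl.
  by apply/asboolP/asboolP; exact: tensor_eq_sym.
by move=> /asboolP st /asboolP tu; exact/asboolP/(tensor_eq_trans st tu).
Qed.

Canonical tensor_equiv := EquivRelPack tensor_eqb_equiv.

Definition tensor : Type := {eq_quot tensor_equiv}.
HB.instance Definition _ := Choice.on tensor.
HB.instance Definition _ := EqQuotient.on tensor.

Definition tensor_sum (s : seq (M * N)) : tensor := \pi_tensor s.

Definition tens (x : M) (y : N) : tensor := tensor_sum [:: (x, y)].

Definition tensor_scale_seq (a : R) (s : seq (M * N)) : seq (M * N) :=
  [seq (a *: p.1, p.2) | p <- s].

Definition tensor_zero : tensor := tensor_sum [::].
Definition tensor_add (u v : tensor) : tensor := tensor_sum (repr u ++ repr v).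
Definition tensor_scale (a : R) (u : tensor) : tensor :=
  tensor_sum (tensor_scale_seq a (repr u)).
Definition tensor_opp (u : tensor) : tensor := tensor_scale (-1) u.

Lemma tensor_sumP s t : tensor_sum s = tensor_sum t <-> tensor_eq s t.
Proof.
split=> [/eqP|st]; first by rewrite eqquotE => /asboolP.
by apply/eqP; rewrite eqquotE; apply/asboolP.
Qed.

Lemma tensor_sum_repr u : tensor_sum (repr u) = u.
Proof. exact: reprK. Qed.

Lemma tensor_repr_eq s : tensor_eq (repr (tensor_sum s)) s.
Proof. by apply/tensor_sumP; rewrite tensor_sum_repr. Qed.

Lemma tensor_scale_seq_eq a s t :
  tensor_eq s t -> tensor_eq (tensor_scale_seq a s) (tensor_scale_seq a t).
Proof.
elim=> {s t} /=.
- by move=> s; exact: tensor_eq_refl.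
- by move=> s t _; exact: tensor_eq_sym.
- by move=> s t u _ + _; exact: tensor_eq_trans.
- move=> s s' t t' _ st _ st'; rewrite /tensor_scale_seq !map_cat.
  exact: tensor_eq_cat.
- move=> s t; rewrite /tensor_scale_seq !map_cat; exact: tensor_eq_catC.
- by move=> y; rewrite scaler0; exact: tensor_eq_0l.
- by move=> x x' y; rewrite scalerDr; exact: tensor_eq_Dl.
- by move=> x y y'; exact: tensor_eq_Dr.
- move=> b x y; rewrite scalerA mulrC -scalerA; exact: tensor_eq_Z.
Qed.

Lemma tensor_addE s t :
  tensor_add (tensor_sum s) (tensor_sum t) = tensor_sum (s ++ t).
Proof. by apply/tensor_sumP/tensor_eq_cat; exact: tensor_repr_eq. Qed.

Lemma tensor_scaleE a s :
  tensor_scale a (tensor_sum s) = tensor_sum (tensor_scale_seq a s).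
Proof. by apply/tensor_sumP/tensor_scale_seq_eq; exact: tensor_repr_eq. Qed.

Lemma tensor_addA : associative tensor_add.
Proof.
move=> u v w; rewrite -[u]tensor_sum_repr -[v]tensor_sum_repr.
by rewrite -[w]tensor_sum_repr !tensor_addE catA.
Qed.

Lemma tensor_addC : commutative tensor_add.
Proof. by move=> u v; exact/tensor_sumP/tensor_eq_catC. Qed.

Lemma tensor_add0 : left_id tensor_zero tensor_add.
Proof. by move=> u; rewrite -[u]tensor_sum_repr tensor_addE. Qed.

Lemma tensor_sum_cons p s :
  tensor_sum (p :: s) = tensor_add (tens p.1 p.2) (tensor_sum s).
Proof. by case: p => x y; rewrite tensor_addE. Qed.

Lemma tensor_scaleDr a : {morph tensor_scale a : u v / tensor_add u v}.
Proof.
move=> u v; rewrite -[u]tensor_sum_repr -[v]tensor_sum_repr.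
by rewrite tensor_addE !tensor_scaleE tensor_addE /tensor_scale_seq map_cat.
Qed.

Lemma tensor_scaleDl u a b :
  tensor_scale (a + b) u = tensor_add (tensor_scale a u) (tensor_scale b u).
Proof.
rewrite -[u]tensor_sum_repr; elim: (repr u) => [|[x y] s IHs].
  by rewrite !tensor_scaleE tensor_addE.
rewrite tensor_sum_cons !tensor_scaleDr IHs /=.
have -> : tensor_scale (a + b) (tens x y) =
    tensor_add (tensor_scale a (tens x y)) (tensor_scale b (tens x y)).
  rewrite !tensor_scaleE tensor_addE /= scalerDl.
  exact/tensor_sumP/tensor_eq_Dl.
rewrite -!tensor_addA; congr (tensor_add _ _).
by rewrite !tensor_addA; congr (tensor_add _ _); rewrite tensor_addC.
Qed.

Lemma tensor_scaleA a b u :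
  tensor_scale a (tensor_scale b u) = tensor_scale (a * b) u.
Proof.
rewrite -[u]tensor_sum_repr !tensor_scaleE /tensor_scale_seq -map_comp.
by congr tensor_sum; apply: eq_map => -[x y] /=; rewrite scalerA.
Qed.

Lemma tensor_scale1 : left_id 1 tensor_scale.
Proof.
move=> u; rewrite -[u]tensor_sum_repr tensor_scaleE /tensor_scale_seq.
by congr tensor_sum; apply: map_id_in => -[x y] _ /=; rewrite scale1r.
Qed.

Lemma tensor_scale0 u : tensor_scale 0 u = tensor_zero.
Proof.
rewrite -[u]tensor_sum_repr; elim: (repr u) => [|[x y] s IHs].
  by rewrite tensor_scaleE.
rewrite tensor_sum_cons tensor_scaleDr IHs tensor_addC tensor_add0.
by rewrite tensor_scaleE /= scale0r; exact/tensor_sumP/tensor_eq_0l.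
Qed.

Lemma tensor_addN : left_inverse tensor_zero tensor_opp tensor_add.
Proof.
move=> u; rewrite -{2}[u]tensor_scale1 -tensor_scaleDl addNr.
exact: tensor_scale0.
Qed.

HB.instance Definition _ := GRing.isZmodule.Build tensor
  tensor_addA tensor_addC tensor_add0 tensor_addN.

HB.instance Definition _ := GRing.Zmodule_isLmodule.Build R tensor
  tensor_scaleA tensor_scale1 tensor_scaleDr tensor_scaleDl.

Lemma tensorDl x x' y : tens (x + x') y = tens x y + tens x' y.
Proof. by rewrite [RHS]tensor_addE; exact/tensor_sumP/tensor_eq_Dl. Qed.

Lemma tensorDr x y y' : tens x (y + y') = tens x y + tens x y'.
Proof. by rewrite [RHS]tensor_addE; exact/tensor_sumP/tensor_eq_Dr. Qed.

Lemma tensorZl a x y : tens (a *: x) y = a *: tens x y.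
Proof. by rewrite [RHS]tensor_scaleE. Qed.

Lemma tensorZr a x y : tens x (a *: y) = a *: tens x y.
Proof. by rewrite -tensorZl; apply/esym/tensor_sumP/tensor_eq_Z. Qed.

Lemma tensor_sumE s : tensor_sum s = \sum_(p <- s) tens p.1 p.2.
Proof.
elim: s => [|p s IHs]; first by rewrite big_nil.
by rewrite tensor_sum_cons IHs big_cons.
Qed.

Lemma tensor_universal (P : lmodType R) (f : M -> N -> P) :
  (forall y, linear (f^~ y)) -> (forall x, linear (f x)) ->
  exists! g : tensor -> P, linear g /\ forall x y, g (tens x y) = f x y.
Proof.
move=> fl fr.
pose F s := \sum_(p <- s) f p.1 p.2.
have flD x x' y : f (x + x') y = f x y + f x' y.
  by have := fl y 1 x x'; rewrite !scale1r.
have frD x y y' : f x (y + y') = f x y + f x y'.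
  by have := fr x 1 y y'; rewrite !scale1r.
have fl0 y : f 0 y = 0 by apply: (addrI (f 0 y)); rewrite -flD !addr0.
have fr0 x : f x 0 = 0 by apply: (addrI (f x 0)); rewrite -frD !addr0.
have flZ a x y : f (a *: x) y = a *: f x y.
  by have := fl y a x 0; rewrite fl0 !addr0.
have frZ a x y : f x (a *: y) = a *: f x y.
  by have := fr x a y 0; rewrite fr0 !addr0.
have F_eq s t : tensor_eq s t -> F s = F t.
  elim=> {s t} // [s t u _ -> _ -> //|s s' t t' _ + _|s t|y|x x' y|x y y'|a x y].
  - by rewrite /F !big_cat /= => -> ->.
  - by rewrite /F !big_cat /= addrC.
  - by rewrite /F big_seq1 big_nil fl0.
  - by rewrite /F !big_cons big_nil !addr0 flD.
  - by rewrite /F !big_cons big_nil !addr0 frD.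
  - by rewrite /F !big_seq1 flZ frZ.
have FE s : F (repr (tensor_sum s)) = F s by exact/F_eq/tensor_repr_eq.
exists (fun u => F (repr u)); split; first split.
- move=> a u v.
  have -> : a *: u + v = tensor_sum (tensor_scale_seq a (repr u) ++ repr v).
    by rewrite -tensor_addE tensor_sum_repr.
  rewrite FE /F big_cat /= big_map scaler_sumr; congr (_ + _).
  by apply: eq_bigr => p _; rewrite flZ.
- by move=> x y; rewrite FE /F big_seq1.
move=> g [glin gE]; apply: funext => u.
have gD v w : g (v + w) = g v + g w by have := glin 1 v w; rewrite !scale1r.
have g0 : g 0 = 0 by apply: (addrI (g 0)); rewrite -gD !addr0.
rewrite -[in RHS](tensor_sum_repr u) tensor_sumE /F.
elim: (repr u) => [|p s IHs]; first by rewrite !big_nil g0.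
by rewrite !big_cons gD gE IHs.
Qed.

End Tensor.

(* The localization M_p of an R-module at a prime ideal p: fractions x / s    *)
(* with s \notin p, where x / s = y / t iff u (t x - s y) = 0 for some u      *)
(* outside p. The ring R_p is the case M = R^o.                               *)
Section Localization.
Variables (R : comNzRingType) (p : prime_idealr R).

Record denom := Denom { dval : R; dvalP : dval \notin p }.
HB.instance Definition _ := [isSub for dval].
HB.instance Definition _ := [Choice of denom by <:].

Lemma denom_one_subproof : 1 \notin p.
Proof. by rewrite idealr1. Qed.
Definition denom1 : denom :=
  Denom denom_one_subproof.

Lemma denom_mul_subproof (s t : denom) : dval s * dval t \notin p.
Proof. by rewrite prime_idealrM negb_or (dvalP s) (dvalP t). Qed.
Definition denomM (s t : denom) : denom :=
  Denom (denom_mul_subproof s t).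

Section LocalModule.
Variable M : lmodType R.

Definition frac_eq (f g : M * denom) : Prop :=
  exists u : denom, dval u *: (dval g.2 *: f.1 - dval f.2 *: g.1) = 0.

Lemma frac_eqE x s y t : frac_eq (x, s) (y, t) <->
  exists u : denom, (dval u * dval t) *: x = (dval u * dval s) *: y.
Proof.
split=> -[u /= Hu]; exists u; last by rewrite scalerBr !scalerA Hu subrr.
by move: Hu; rewrite scalerBr !scalerA => /subr0_eq.
Qed.

Definition frac_eqb (f g : M * denom) : bool := `[< frac_eq f g >].

Lemma frac_eqb_equiv : equiv_class_of frac_eqb.
Proof.
split=> [f|f g|g f h].
- by apply/asboolP; exists denom1; rewrite subrr scaler0.
- by apply/asboolP/asboolP => -[u Hu]; exists u; rewrite -opprB scalerN Hu oppr0.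
- case: f g h => [x s] [y t] [z r] /asboolP/frac_eqE[u Hu].
  move=> /asboolP/frac_eqE[v Hv].
  apply/asboolP/frac_eqE; exists (denomM t (denomM u v)) => /=.
  have -> : dval t * (dval u * dval v) * dval r =
    dval v * dval r * (dval u * dval t) by ring.
  rewrite -scalerA Hu scalerA.
  have -> : dval v * dval r * (dval u * dval s) =
    dval u * dval s * (dval v * dval r) by ring.
  rewrite -scalerA Hv scalerA; congr (_ *: _); ring.
Qed.

Canonical frac_equiv := EquivRelPack frac_eqb_equiv.

Definition localization : Type := {eq_quot frac_equiv}.
HB.instance Definition _ := Choice.on localization.
HB.instance Definition _ := EqQuotient.on localization.

Definition frac (x : M) (s : denom) : localization := \pi_localization (x, s).

Lemma fracP x s y t : frac x s = frac y t <->
  exists u : denom, (dval u * dval t) *: x = (dval u * dval s) *: y.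
Proof.
rewrite -frac_eqE; split=> [/eqP|st].
  by rewrite eqquotE => /asboolP.
by apply/eqP; rewrite eqquotE; apply/asboolP.
Qed.

Lemma fracE (v : localization) : frac (repr v).1 (repr v).2 = v.
Proof. by rewrite /frac -surjective_pairing reprK. Qed.

Lemma frac_surj (v : localization) : exists x s, v = frac x s.
Proof. by exists (repr v).1, (repr v).2; rewrite fracE. Qed.

Lemma frac_repr x s : exists u : denom,
  (dval u * dval s) *: (repr (frac x s)).1 =
  (dval u * dval (repr (frac x s)).2) *: x.
Proof. by apply/fracP; rewrite fracE. Qed.

Definition loc_zero : localization := frac 0 denom1.
Definition loc_opp (v : localization) : localization :=
  frac (- (repr v).1) (repr v).2.
Definition loc_add (v w : localization) : localization :=
  frac (dval (repr w).2 *: (repr v).1 + dval (repr v).2 *: (repr w).1)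
       (denomM (repr v).2 (repr w).2).

Lemma loc_oppE x s : loc_opp (frac x s) = frac (- x) s.
Proof.
have [u Hu] := frac_repr x s; apply/fracP; exists u.
by rewrite !scalerN Hu.
Qed.

Lemma loc_addE x s y t : loc_add (frac x s) (frac y t) =
  frac (dval t *: x + dval s *: y) (denomM s t).
Proof.
rewrite /loc_add; have [u] := frac_repr x s; have [v] := frac_repr y t.
case: (repr (frac x s)) (repr (frac y t)) => [x' s'] [y' t'] /= Hv Hu.
apply/fracP; exists (denomM u v) => /=.
rewrite !scalerDr !scalerA; congr (_ + _).
  have -> : dval u * dval v * (dval s * dval t) * dval t' =
    dval v * dval t * dval t' * (dval u * dval s) by ring.
  by rewrite -scalerA Hu scalerA; congr (_ *: _); ring.
have -> : dval u * dval v * (dval s * dval t) * dval s' =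
  dval u * dval s * dval s' * (dval v * dval t) by ring.
by rewrite -scalerA Hv scalerA; congr (_ *: _); ring.
Qed.

Lemma frac_scale u x s : frac (dval u *: x) (denomM u s) = frac x s.
Proof.
by apply/fracP; exists denom1 => /=; rewrite scalerA; congr (_ *: _); ring.
Qed.

Lemma loc_addA : associative loc_add.
Proof.
move=> u v w; have [x [s ->]] := frac_surj u; have [y [t ->]] := frac_surj v.
have [z [r ->]] := frac_surj w; rewrite !loc_addE.
apply/fracP; exists denom1; rewrite /= !scalerDr !scalerA -!addrA.
by congr (_ *: _ + (_ *: _ + _ *: _)); ring.
Qed.

Lemma loc_addC : commutative loc_add.
Proof.
move=> u v; have [x [s ->]] := frac_surj u; have [y [t ->]] := frac_surj v.
rewrite !loc_addE.
apply/fracP; exists denom1; rewrite /= addrC; congr (_ *: _); ring.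
Qed.

Lemma loc_add0 : left_id loc_zero loc_add.
Proof.
move=> u; have [x [s ->]] := frac_surj u; rewrite loc_addE; apply/fracP; exists denom1.
by rewrite /= scaler0 add0r scale1r !mul1r.
Qed.

Lemma loc_addN : left_inverse loc_zero loc_opp loc_add.
Proof.
move=> u; have [x [s ->]] := frac_surj u; rewrite loc_oppE loc_addE; apply/fracP; exists denom1.
by rewrite /= scalerN addNr !scaler0.
Qed.

HB.instance Definition _ := GRing.isZmodule.Build localization
  loc_addA loc_addC loc_add0 loc_addN.

Lemma frac_addE x s y t :
  frac x s + frac y t = frac (dval t *: x + dval s *: y) (denomM s t).
Proof. exact: loc_addE. Qed.

End LocalModule.

Definition loc_ring : Type := localization R^o.
HB.instance Definition _ := GRing.Zmodule.on loc_ring.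

Definition loc_frac (a : R) (s : denom) : loc_ring := frac (a : R^o) s.

Lemma loc_fracP a s b t : loc_frac a s = loc_frac b t <->
  exists u : denom, dval u * dval t * a = dval u * dval s * b.
Proof. exact: fracP. Qed.

Lemma loc_frac_surj (a : loc_ring) : exists x s, a = loc_frac x s.
Proof. by have [x [s ->]] := @frac_surj R^o a; exists x, s. Qed.

Lemma loc_frac_addE a s b t : loc_frac a s + loc_frac b t =
  loc_frac (dval t * a + dval s * b) (denomM s t).
Proof. exact: frac_addE. Qed.

Definition loc_scale (M : lmodType R) (a : loc_ring) (v : localization M) :
    localization M :=
  frac (((repr a).1 : R) *: (repr v).1) (denomM (repr a).2 (repr v).2).

Definition loc_one : loc_ring := loc_frac 1 denom1.
Definition loc_mul (a b : loc_ring) : loc_ring := loc_scale (M := R^o) a b.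

Lemma loc_scaleE (M : lmodType R) (a : R) s (x : M) t :
  loc_scale (loc_frac a s) (frac x t) = frac (a *: x) (denomM s t).
Proof.
rewrite /loc_scale.
have [u] : exists u : denom, dval u * dval s * (repr (loc_frac a s)).1 =
    dval u * dval (repr (loc_frac a s)).2 * a := frac_repr (a : R^o) s.
have [v] := frac_repr x t.
case: (repr (frac x t)) (repr (loc_frac a s)) => [x' t'] [a' s'] /= Hv Hu.
apply/fracP; exists (denomM u v) => /=; rewrite !scalerA.
have -> : dval u * dval v * (dval s * dval t) * a' =
  (dval u * dval s * a') * (dval v * dval t) by ring.
by rewrite -scalerA Hv scalerA Hu; congr (_ *: _); ring.
Qed.

Lemma loc_mulE a s b t :
  loc_mul (loc_frac a s) (loc_frac b t) = loc_frac (a * b) (denomM s t).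
Proof. exact: loc_scaleE. Qed.

Lemma loc_mulA : associative loc_mul.
Proof.
move=> a b c; have [x [s ->]] := loc_frac_surj a.
have [y [t ->]] := loc_frac_surj b; have [z [r ->]] := loc_frac_surj c.
by rewrite !loc_mulE; apply/loc_fracP; exists denom1 => /=; ring.
Qed.

Lemma loc_mulC : commutative loc_mul.
Proof.
move=> a b; have [x [s ->]] := loc_frac_surj a.
have [y [t ->]] := loc_frac_surj b.
by rewrite !loc_mulE; apply/loc_fracP; exists denom1 => /=; ring.
Qed.

Lemma loc_mul1 : left_id loc_one loc_mul.
Proof.
move=> a; have [x [s ->]] := loc_frac_surj a.
by rewrite loc_mulE; apply/loc_fracP; exists denom1 => /=; ring.
Qed.

Lemma loc_mulDl : left_distributive loc_mul +%R.
Proof.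
move=> a b c; have [x [s ->]] := loc_frac_surj a.
have [y [t ->]] := loc_frac_surj b; have [z [r ->]] := loc_frac_surj c.
rewrite loc_frac_addE !loc_mulE loc_frac_addE.
by apply/loc_fracP; exists denom1 => /=; ring.
Qed.

Lemma loc_one_neq0 : loc_one != 0.
Proof.
apply/eqP => /loc_fracP[u]; rewrite mulr0 /= !mulr1 => u0.
by have := dvalP u; rewrite u0 idealr0.
Qed.

HB.instance Definition _ := GRing.Zmodule_isComNzRing.Build loc_ring
  loc_mulA loc_mulC loc_mul1 loc_mulDl loc_one_neq0.

Section LocalScale.
Variable M : lmodType R.
Implicit Types (a b : loc_ring) (v w : localization M).

Lemma loc_scaleA a b v : loc_scale a (loc_scale b v) = loc_scale (a * b) v.
Proof.
have [x [s ->]] := loc_frac_surj a; have [y [t ->]] := loc_frac_surj b.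
have [z [r ->]] := frac_surj v; rewrite [_ * _]loc_mulE !loc_scaleE.
by apply/fracP; exists denom1; rewrite /= !scalerA; congr (_ *: _); ring.
Qed.

Lemma loc_scale1 : left_id 1 (@loc_scale M).
Proof.
move=> v; have [x [s ->]] := frac_surj v; rewrite loc_scaleE.
by apply/fracP; exists denom1; rewrite /= !scalerA; congr (_ *: _); ring.
Qed.

Lemma loc_scaleDr : right_distributive (@loc_scale M) +%R.
Proof.
move=> a v w; have [x [s ->]] := loc_frac_surj a.
have [y [t ->]] := frac_surj v; have [z [r ->]] := frac_surj w.
rewrite frac_addE !loc_scaleE frac_addE.
by apply/fracP; exists denom1; rewrite /= !(scalerDr, scalerA);
  congr (_ *: _ + _ *: _); ring.
Qed.

Lemma loc_scaleDl v : {morph (@loc_scale M)^~ v : a b / a + b}.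
Proof.
move=> a b; have [x [s ->]] := loc_frac_surj a.
have [y [t ->]] := loc_frac_surj b; have [z [r ->]] := frac_surj v.
rewrite loc_frac_addE !loc_scaleE frac_addE.
apply/fracP; exists denom1; rewrite /= !scalerA -scalerDl scalerA.
by congr (_ *: _); ring.
Qed.

End LocalScale.

HB.instance Definition _ (M : lmodType R) :=
  GRing.Zmodule_isLmodule.Build loc_ring (localization M)
    (@loc_scaleA M) (@loc_scale1 M) (@loc_scaleDr M) (@loc_scaleDl M).

End Localization.

Definition locally_free_on_punctured_spectrum (R : comNzRingType)
    (m : idealr R) (M : lmodType R) : Prop :=
  forall p : prime_idealr R, ~ (p =i m) ->
    free_module (localization p M : lmodType (loc_ring p)).

(* Main.v *)
Require Import Defs.
From mathcomp Require Import all_boot all_order all_algebra.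
From mathcomp Require Import boolp classical_sets constructive_ereal ereal.
From HB Require Import structures.
From mathcomp Require Import functions ring.
Import Defs.

(** Let M be finitely generated and locally free on the punctured spectrum, with
    pd M <= a and pd N <= b, and let x1, ..., xd be a regular sequence in the
    maximal ideal m with a + b <= d.  Then pd (M (x) N) <= a + b; the
    theorem is the case M = N, a = b = pd M, d = depth R.

    The proof is an induction on a along a syzygy 0 -> K -> P -> M -> 0 with P
    projective (lemma [pdle_tensor]).  By induction pd (K (x) N) <= a - 1 + b.
    If K (x) N -> P (x) N is injective, then
    0 -> K (x) N -> P (x) N -> M (x) N -> 0 is exact, and since
    pd (P (x) N) <= b this bounds pd (M (x) N).  The kernel of that map, which
    is Tor_1 (M, N), vanishes because two opposite facts meet:

    - it is torsion.  For x in m, the ideal of those s for which s . id_M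
      factors through a projective module contains a power of x: otherwise it
      would lie in a prime avoiding x, at which M is free, hence split off a
      projective up to a denominator (lemmas [free_localization_split] and
      [locally_free_split_by]).  Such a factorization of s . id_M passes to
      the syzygy K (lemma [split_by_syzygy]), which carries the hypothesis
      through the induction although K need not be finitely generated, and it
      makes s kill the kernel;
    - it lies in a module of positive depth.  A module of projective dimension
      smaller than d has no nonzero element killed by powers of x1, ..., xd
      (lemma [pdle_torsion_free]); this is the part of the Auslander-Buchsbaum
      inequality that the argument uses.

    Bounds on projective dimension are handled by the recursive predicate
    [pdle], whose stability under extensions and cokernels replaces Ext. *)

Set Implicit Arguments.
Unset Strict Implicit.
Unset Printing Implicit Defensive.

Import Order.TTheory GRing.Theory Num.Theory.

Local Open Scope ring_scope.
Local Open Scope quotient_scope.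

(** * Kernels and quotients by a ring element *)

Section LinearMaps.
Variable A : pzRingType.

Lemma linear_bundle (V W : lmodType A) (f : V -> W) :
  linear f -> exists g : {linear V -> W}, g =1 f.
Proof.
move=> fl; pose F := GRing.isLinear.Build A V W *:%R f fl.
pose g : {linear V -> W} := HB.pack f F.
by exists g.
Qed.

Lemma linear_inj0 (V W : lmodType A) (f : {linear V -> W}) :
  (forall x, f x = 0 -> x = 0) -> injective f.
Proof.
by move=> f0 x y /eqP; rewrite -subr_eq0 -linearB => /eqP/f0/subr0_eq.
Qed.

End LinearMaps.

Section Submodule.
Variables (A : pzRingType) (V : lmodType A) (S : submodClosed V).

Record submod := Submod { submod_val : V; submod_valP : submod_val \in S }.
HB.instance Definition _ := [isSub for submod_val].
HB.instance Definition _ := [Choice of submod by <:].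
HB.instance Definition _ := [SubChoice_isSubLmodule of submod by <:].

End Submodule.

Section Kernel.
Variables (A : pzRingType) (V W : lmodType A) (f : {linear V -> W}).

Definition ker_pred : {pred V} := fun x => f x == 0.

Lemma ker_pred_submod : submod_closed ker_pred.
Proof.
split=> [|a x y]; rewrite !unfold_in ?raddf0 // => /eqP fx /eqP fy.
by rewrite linearP fx fy scaler0 addr0.
Qed.
HB.instance Definition _ := GRing.isSubmodClosed.Build A V ker_pred
  ker_pred_submod.

Definition kernel : lmodType A := submod ker_pred.
Definition ker_incl : {linear kernel -> V} := \val.

Lemma ker_incl_inj : injective ker_incl. Proof. exact: val_inj. Qed.

Lemma ker_inclK k : f (ker_incl k) = 0. Proof. exact/eqP/(valP k). Qed.

Lemma ker_inclP x : f x = 0 -> exists k, ker_incl k = x.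
Proof. by move=> /eqP fx; exists (Submod (fx : x \in ker_pred)). Qed.

End Kernel.
Arguments ker_incl_inj {A V W} f.
Arguments ker_incl : simpl never.

Section QuotientByElement.
Variables (R : comNzRingType) (y : R) (V : lmodType R).

(** The congruence defining V / y V. *)
Definition eltq_eqb (u v : V) : bool := `[< exists w, u - v = y *: w >].

Lemma eltq_equiv_subproof : equiv_class_of eltq_eqb.
Proof.
split=> [u|u v|u v w]; first by apply/asboolP; exists 0; rewrite subrr scaler0.
  by apply/asboolP/asboolP => -[w uv]; exists (- w); rewrite scalerN -uv opprB.
move=> /asboolP[a vu] /asboolP[b vw]; apply/asboolP; exists (a + b).
by rewrite scalerDr -vu -vw addrA subrK.
Qed.
Canonical eltq_equiv := EquivRelPack eltq_equiv_subproof.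

Definition eltq : Type := {eq_quot eltq_equiv}.
HB.instance Definition _ := Choice.on eltq.
HB.instance Definition _ := EqQuotient.on eltq.

Definition eltq_class (u : V) : eltq := \pi_eltq u.

Lemma eltq_classP u v : eltq_class u = eltq_class v <-> exists w, u - v = y *: w.
Proof.
split=> [/eqP|uv]; first by rewrite eqquotE => /asboolP.
by apply/eqP; rewrite eqquotE; apply/asboolP.
Qed.

Lemma eltq_surj (q : eltq) : exists u, q = eltq_class u.
Proof. by exists (repr q); rewrite /eltq_class reprK. Qed.

Lemma eltq_repr u : exists w, repr (eltq_class u) = u + y *: w.
Proof.
have /eltq_classP[w uw] : eltq_class (repr (eltq_class u)) = eltq_class u.
  by rewrite {1}/eltq_class reprK.
by exists w; rewrite -uw addrC subrK.
Qed.

Definition eltq_zero : eltq := eltq_class 0.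
Definition eltq_add (p q : eltq) : eltq := eltq_class (repr p + repr q).
Definition eltq_opp (p : eltq) : eltq := eltq_class (- repr p).
Definition eltq_scale a (p : eltq) : eltq := eltq_class (a *: repr p).

Lemma eltq_addE u v : eltq_add (eltq_class u) (eltq_class v) = eltq_class (u + v).
Proof.
rewrite /eltq_add; have [a ->] := eltq_repr u; have [b ->] := eltq_repr v.
apply/eltq_classP; exists (a + b).
by rewrite scalerDr addrACA [LHS]addrAC subrr add0r.
Qed.

Lemma eltq_oppE u : eltq_opp (eltq_class u) = eltq_class (- u).
Proof.
rewrite /eltq_opp; have [a ->] := eltq_repr u.
apply/eltq_classP; exists (- a).
by rewrite scalerN opprD opprK addrAC addNr add0r.
Qed.

Lemma eltq_scaleE a u : eltq_scale a (eltq_class u) = eltq_class (a *: u).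
Proof.
rewrite /eltq_scale; have [b ->] := eltq_repr u.
apply/eltq_classP; exists (a *: b).
by rewrite scalerDr addrAC subrr add0r !scalerA mulrC.
Qed.

Lemma eltq_addA : associative eltq_add.
Proof.
move=> p q r; have [u ->] := eltq_surj p; have [v ->] := eltq_surj q.
by have [w ->] := eltq_surj r; rewrite !eltq_addE addrA.
Qed.

Lemma eltq_addC : commutative eltq_add.
Proof. by move=> p q; rewrite /eltq_add addrC. Qed.

Lemma eltq_add0 : left_id eltq_zero eltq_add.
Proof. by move=> p; have [u ->] := eltq_surj p; rewrite eltq_addE add0r. Qed.

Lemma eltq_addN : left_inverse eltq_zero eltq_opp eltq_add.
Proof.
by move=> p; have [u ->] := eltq_surj p; rewrite eltq_oppE eltq_addE addNr.
Qed.

HB.instance Definition _ := GRing.isZmodule.Build eltq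
  eltq_addA eltq_addC eltq_add0 eltq_addN.

Lemma eltq_scaleA a b p : eltq_scale a (eltq_scale b p) = eltq_scale (a * b) p.
Proof. by have [u ->] := eltq_surj p; rewrite !eltq_scaleE scalerA. Qed.

Lemma eltq_scale1 : left_id 1 eltq_scale.
Proof. by move=> p; have [u ->] := eltq_surj p; rewrite eltq_scaleE scale1r. Qed.

Lemma eltq_scaleDr : right_distributive eltq_scale +%R.
Proof.
move=> a p q; have [u ->] := eltq_surj p; have [v ->] := eltq_surj q.
by rewrite [_ + _]eltq_addE !eltq_scaleE [RHS]eltq_addE scalerDr.
Qed.

Lemma eltq_scaleDl p : {morph eltq_scale^~ p : a b / a + b}.
Proof.
move=> a b; have [u ->] := eltq_surj p.
by rewrite !eltq_scaleE [RHS]eltq_addE scalerDl.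
Qed.

HB.instance Definition _ := GRing.Zmodule_isLmodule.Build R eltq
  eltq_scaleA eltq_scale1 eltq_scaleDr eltq_scaleDl.

Lemma eltq_classD u v : eltq_class (u + v) = eltq_class u + eltq_class v.
Proof. by rewrite [RHS]eltq_addE. Qed.

Lemma eltq_classZ a u : eltq_class (a *: u) = a *: eltq_class u.
Proof. by rewrite [RHS]eltq_scaleE. Qed.

Lemma eltq_class_eq0 u : eltq_class u = 0 <-> exists w, u = y *: w.
Proof. by rewrite eltq_classP subr0. Qed.

End QuotientByElement.

Section QuotientMap.
Variables (R : comNzRingType) (y : R) (V W : lmodType R) (f : {linear V -> W}).

Lemma eltq_map : exists g : {linear eltq y V -> eltq y W},
  forall u, g (eltq_class y u) = eltq_class y (f u).
Proof.
pose h (q : eltq y V) := eltq_class y (f (repr q)).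
have hE u : h (eltq_class y u) = eltq_class y (f u).
  rewrite /h; have [w ->] := eltq_repr y u; apply/eltq_classP.
  by exists (f w); rewrite linearD linearZ /= addrAC subrr add0r.
have hl : linear h.
  move=> a p q; have [u ->] := eltq_surj p; have [v ->] := eltq_surj q.
  by rewrite -eltq_classZ -eltq_classD !hE linearP eltq_classD eltq_classZ.
by have [g gE] := linear_bundle hl; exists g => u; rewrite gE.
Qed.

End QuotientMap.

(** * Bounds on projective dimension by iterated syzygies *)

Section Exactness.
Variable A : pzRingType.

Definition short_exact (K P M : lmodType A)
    (i : {linear K -> P}) (g : {linear P -> M}) : Prop :=
  [/\ injective i, forall c, exists b, g b = c &
      forall b, g b = 0 <-> exists a, i a = b].

Lemma ker_short_exact (P M : lmodType A) (g : {linear P -> M}) :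
  (forall c, exists b, g b = c) -> short_exact (ker_incl g) g.
Proof.
move=> gs; split=> // b.
split=> [/ker_inclP //|[k <-]]; exact: ker_inclK.
Qed.

Lemma linear_factor_inj (V B K : lmodType A) (i : {linear K -> B})
    (f : {linear V -> B}) :
  injective i -> (forall v, exists a, i a = f v) ->
  exists h : {linear V -> K}, forall v, i (h v) = f v.
Proof.
move=> ii /choice[h hE].
have hl : linear h by move=> a x y; apply: ii; rewrite linearP !hE linearP.
by have [g gE] := linear_bundle hl; exists g => v; rewrite gE.
Qed.

Lemma projective_lift (P V W : lmodType A) (g : {linear V -> W})
    (f : {linear P -> W}) :
  projective P -> (forall w, exists v, g v = w) ->
  exists h : {linear P -> V}, forall x, g (h x) = f x.
Proof.
move=> pP gs; apply: pP; apply/seteqP; split=> // w _.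
by have [v <-] := gs w; exists v.
Qed.

Lemma projectiveP (P : lmodType A) :
  (forall (V W : lmodType A) (g : {linear V -> W}) (f : {linear P -> W}),
     (forall w, exists v, g v = w) ->
     exists h : {linear P -> V}, forall x, g (h x) = f x) ->
  projective P.
Proof.
move=> lift V W g f gT; apply: lift => w.
have : setT w by [].
by rewrite -gT => -[v _ <-]; exists v.
Qed.

Lemma projective_bij (P Q : lmodType A) (f : {linear P -> Q}) :
  bijective f -> projective P -> projective Q.
Proof.
case=> f' fK f'K pP; apply: projectiveP => V W g k gs.
have [h hE] := projective_lift (k \o f) pP gs.
have f'l : linear f' by move=> a x y; apply: (can_inj fK); rewrite linearP !f'K.
have [f'' f''E] := linear_bundle f'l.
by exists (h \o f'') => x /=; rewrite hE /= f''E f'K.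
Qed.

Lemma projective_zero (P : lmodType A) : zero_module P -> projective P.
Proof.
move=> P0; apply: projectiveP => V W g f _.
have zl : linear (fun _ : P => 0 : V) by move=> a x y; rewrite scaler0 addr0.
have [z zE] := linear_bundle zl.
by exists z => x; rewrite zE (P0 x) !raddf0.
Qed.

Lemma projective_pair (P Q : lmodType A) :
  projective P -> projective Q -> projective (P * Q)%type.
Proof.
move=> pP pQ; apply: projectiveP => V W g f gs.
have f1l : linear (fun x : P => f (x, 0)).
  by move=> a x y; rewrite -linearP; congr (f (_, _)); rewrite /= scaler0 addr0.
have f2l : linear (fun x : Q => f (0, x)).
  by move=> a x y; rewrite -linearP; congr (f (_, _)); rewrite /= scaler0 addr0.
have [f1 f1E] := linear_bundle f1l; have [f2 f2E] := linear_bundle f2l.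
have [h1 h1E] := projective_lift f1 pP gs.
have [h2 h2E] := projective_lift f2 pQ gs.
have hl : linear (fun z : P * Q => h1 z.1 + h2 z.2).
  move=> a [x1 x2] [y1 y2]; rewrite [LHS]/= !linearP /= scalerDr.
  by rewrite addrACA.
have [h hE] := linear_bundle hl.
exists h => -[x y]; rewrite hE linearD /= h1E h2E f1E f2E -linearD.
by congr (f (_, _)); rewrite /= ?addr0 ?add0r.
Qed.

(** The projective modules P 0, P 1, ... of a resolution are peeled off one
    syzygy at a time, so that inductions on the length never manipulate a
    whole complex. *)
Fixpoint pdle (n : nat) (M : lmodType A) : Prop :=
  if n is k.+1 then
    exists (K P : lmodType A) (i : {linear K -> P}) (g : {linear P -> M}),
      [/\ short_exact i g, projective P & pdle k K]
  else projective M.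

Lemma pdle_succ n (M : lmodType A) : pdle n M -> pdle n.+1 M.
Proof.
elim: n M => [|n IHn] M; last first.
  by case=> K [P [i [g [ex pP /IHn pK]]]]; exists K, P, i, g.
move=> pM; pose g : {linear M -> M} := idfun.
exists (kernel g), M, (ker_incl g), g; split=> //.
  by apply: ker_short_exact => c; exists c.
apply: projective_zero => k; apply: (ker_incl_inj g).
by rewrite raddf0; apply: (ker_inclK k).
Qed.

Lemma pdle_leq n k (M : lmodType A) : (n <= k)%N -> pdle n M -> pdle k M.
Proof.
move=> /subnK <-; elim: (k - n)%N => // d IHd /IHd.
exact: pdle_succ.
Qed.

(** Horseshoe lemma: projective covers of K and M add up to one of P, and the
    three kernels again form a short exact sequence. *)
Lemma pdle_extension n (K P M : lmodType A)
    (i : {linear K -> P}) (g : {linear P -> M}) :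
  short_exact i g -> pdle n K -> pdle n M -> pdle n P.
Proof.
elim: n K P M i g => [|n IHn] K P M i g [ii gs ex] /=.
  move=> pK pM.
  have [s sE] := projective_lift idfun pM gs.
  (* The sequence splits: b is the sum of s (g b) and an element i (q b). *)
  have rl : linear (fun b => b - s (g b)).
    by move=> a x y; rewrite !linearP /= addrACA scalerDr.
  have [r rE] := linear_bundle rl.
  have [q qE] : exists q : {linear P -> K}, forall b, i (q b) = r b.
    apply: linear_factor_inj => // b.
    by apply/ex; rewrite rE linearB /= sE subrr.
  apply: projectiveP => V W h f hs.
  have [hK hKE] := projective_lift (f \o i) pK hs.
  have [hM hME] := projective_lift (f \o s) pM hs.
  have tl : linear (fun b => hK (q b) + hM (g b)).
    by move=> a x y; rewrite !linearP /= scalerDr addrACA.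
  have [t tE] := linear_bundle tl.
  exists t => x; rewrite tE linearD hKE hME /= qE rE.
  by rewrite -linearD subrK.
case=> K' [P1 [i1 [g1 [[ii1 gs1 ex1] pP1 pK']]]].
case=> M' [P2 [i2 [g2 [[ii2 gs2 ex2] pP2 pM']]]].
have [l lE] := projective_lift g2 pP2 gs.
(* The cover of P is g1 on P1, pushed into P by i, and a lift l of g2 on P2. *)
have hl : linear (fun z : P1 * P2 => i (g1 z.1) + l z.2).
  by move=> a [x1 x2] [y1 y2]; rewrite [LHS]/= !linearP /= scalerDr addrACA.
have [h hE] := linear_bundle hl.
have hs c : exists b, h b = c.
  have [q qE] := gs2 (g c).
  have /ex[a aE] : g (c - l q) = 0 by rewrite linearB lE qE subrr.
  have [p pE] := gs1 a.
  by exists (p, q); rewrite hE /= pE aE subrK.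
exists (kernel h), (P1 * P2)%type, (ker_incl h), h; split.
- exact: ker_short_exact.
- exact: projective_pair.
have jl : linear (fun x : K' => (i1 x, 0 : P2)).
  move=> a x y; rewrite linearP; congr (_, _).
  by rewrite /= scaler0 addr0.
have [j0 j0E] := linear_bundle jl.
have [j jE] : exists j : {linear K' -> kernel h},
    forall x, ker_incl h (j x) = j0 x.
  apply: linear_factor_inj => [|x]; first exact: (ker_incl_inj h).
  apply: ker_inclP; rewrite hE j0E /= raddf0 addr0.
  by rewrite (_ : g1 _ = 0) ?raddf0 //; apply/ex1; exists x.
have kl : linear (fun x : kernel h => (ker_incl h x).2) by [].
have [k0 k0E] := linear_bundle kl.
have [k kE] : exists k : {linear kernel h -> M'}, forall x, i2 (k x) = k0 x.
  apply: linear_factor_inj => // x; apply/ex2; rewrite k0E -lE.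
  have := ker_inclK x; rewrite hE => /(congr1 g).
  rewrite linearD raddf0 (_ : g (i _) = 0) ?add0r //.
  by apply/ex; eexists.
apply: (IHn _ _ _ j k) pK' pM'; split.
- move=> x y /(congr1 (ker_incl h)); rewrite !jE !j0E => -[].
  exact: ii1.
- move=> c; have /ex[a aE] : g (l (i2 c)) = 0.
    by rewrite lE; apply/ex2; exists c.
  have [p pE] := gs1 a.
  have [x xE] : exists x, ker_incl h x = (- p, i2 c).
    by apply: ker_inclP; rewrite hE /= !raddfN /= pE aE addNr.
  by exists x; apply: ii2; rewrite kE k0E xE.
move=> x; split=> [kx|[y <-]]; last first.
  by apply: ii2; rewrite kE k0E jE j0E raddf0.
have x2 : (ker_incl h x).2 = 0 by rewrite -k0E -kE kx raddf0.
have := ker_inclK x; rewrite hE x2 raddf0 addr0 => ix.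
have /ex1[y yE] : g1 (ker_incl h x).1 = 0 by apply: ii; rewrite ix raddf0.
exists y; apply: (ker_incl_inj h); rewrite jE j0E yE -x2.
by rewrite -surjective_pairing.
Qed.

(** Let Q be a projective cover of P with kernel L, and let E be the kernel of
    the composite Q -> P -> M.  Then E is an extension of K by L. *)
Lemma pdle_cokernel n (K P M : lmodType A)
    (i : {linear K -> P}) (g : {linear P -> M}) :
  short_exact i g -> pdle n K -> pdle n.+1 P -> pdle n.+1 M.
Proof.
move=> [ii gs ex] pK [L [Q [j [b [[ij bs exb] pQ pL]]]]].
pose h : {linear Q -> M} := g \o b.
exists (kernel h), Q, (ker_incl h), h; split=> //.
  apply: ker_short_exact => c; have [p <-] := gs c.
  by have [q <-] := bs p; exists q.
have [k kE] : exists k : {linear L -> kernel h},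
    forall x, ker_incl h (k x) = j x.
  apply: linear_factor_inj => [|x]; first exact: (ker_incl_inj h).
  apply: ker_inclP; rewrite /h /= (_ : b _ = 0) ?raddf0 //.
  by apply/exb; exists x.
have [r rE] : exists r : {linear kernel h -> K},
    forall x, i (r x) = b (ker_incl h x).
  apply: (linear_factor_inj (f := b \o ker_incl h)) => // x.
  by apply/ex; apply: (ker_inclK x).
apply: (pdle_extension (i := k) (g := r)) pL pK; split.
- by move=> x y /(congr1 (ker_incl h)); rewrite !kE => /ij.
- move=> c; have [q qE] := bs (i c).
  have [x xE] : exists x, ker_incl h x = q.
    by apply: ker_inclP; rewrite /h /= qE; apply/ex; exists c.
  by exists x; apply: ii; rewrite rE xE.
move=> x; split=> [rx|[y <-]].
  have /exb[y yE] : b (ker_incl h x) = 0 by have := rE x; rewrite rx raddf0.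
  by exists y; apply: (ker_incl_inj h); rewrite kE.
by apply: ii; rewrite rE raddf0 kE; apply/exb; exists y.
Qed.

End Exactness.

Section Resolutions.
Variable A : nzRingType.

Lemma pdle_of_resolution n (M : lmodType A) :
  has_projective_resolution M n -> pdle n M.
Proof.
elim: n M => [|n IHn] M [P [d [e [[pP P0] eT ex0 exS]]]] /=.
  have es c : exists b, e b = c.
    by have : setT c by []; rewrite -eT => -[b _ <-]; exists b.
  have ei : injective e.
    move=> x y /eqP; rewrite -subr_eq0 -linearB => /eqP/ex0[z _].
    by rewrite (P0 1%N isT z) raddf0 => /esym/subr0_eq.
  have eb : bijective e.
    by have [e' e'E] := choice es; exists e' => x; [apply: ei|]; rewrite e'E.
  exact: projective_bij eb (pP 0%N).
have es c : exists b, e b = c.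
  by have : setT c by []; rewrite -eT => -[b _ <-]; exists b.
exists (kernel e), (P 0%N), (ker_incl e), e; split=> //.
  exact: ker_short_exact.
apply: IHn.
have [e' e'E] : exists e' : {linear P 1%N -> kernel e},
    forall x, ker_incl e (e' x) = d 0%N x.
  apply: linear_factor_inj => [|x]; first exact: (ker_incl_inj e).
  by apply: ker_inclP; apply/ex0; exists x.
exists (fun i => P i.+1), (fun i => d i.+1), e'; split.
- by split=> [i|i ni]; [exact: pP|exact: P0].
- apply/seteqP; split=> // k _.
  have /ex0[x _ xE] := ker_inclK k.
  by exists x => //; apply: (ker_incl_inj e); rewrite e'E.
- move=> x; rewrite -exS -e'E; split=> [->|ex]; first by rewrite raddf0.
  by apply: (ker_incl_inj e); rewrite ex raddf0.
- by move=> i x; exact: exS.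
Qed.

Lemma resolution_of_pdle n (M : lmodType A) :
  pdle n M -> has_projective_resolution M n.
Proof.
elim: n M => [|n IHn] M.
  move=> pM.
  pose P i : lmodType A := if i is 0%N then M else 'rV[A]_0.
  have P0 i x : x = 0 :> P i.+1 by apply/rowP => -[].
  pose d i : {linear P i.+1 -> P i} := \0.
  exists P, d, (idfun : {linear P 0%N -> M}); split.
  - split=> [[|i] //|[|i] // _]; last exact: P0.
    by apply: projective_zero; exact: P0.
  - by apply/seteqP; split=> // x _; exists x.
  - by move=> x; split=> [x0|[y _ <-] //]; exists 0; rewrite // raddf0; apply/esym.
  - by move=> i x; split=> // _; exists 0; rewrite // raddf0 (P0 _ x).
case=> K [Q [i [g [[ii gs ex] pQ /IHn[P [d [e [[pP P0] eT ex0 exS]]]]]]]].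
pose P' k : lmodType A := if k is j.+1 then P j else Q.
pose d' k : {linear P' k.+1 -> P' k} :=
  match k return {linear P' k.+1 -> P' k} with
  | 0%N => (i \o e) | j.+1 => d j end.
exists P', d', (g : {linear P' 0%N -> M}); split.
- by split=> -[|k] //= nk; exact: P0.
- by apply/seteqP; split=> // x _; have [y <-] := gs x; exists y.
- move=> x; rewrite ex; split=> [[k <-]|[y _ <-]]; last by exists (e y).
  have : setT k by [].
  by rewrite -eT => -[y _ <-]; exists y.
- case=> [|k] x /=; last exact: exS.
  apply: iff_trans (ex0 x).
  by split=> [iex|->]; [apply: ii; rewrite iex|]; rewrite raddf0.
Qed.

End Resolutions.

(** * Projective modules and tensor products *)

Section DualBasis.
Variable R : comNzRingType.

Lemma sum_support (X : eqType) (V : zmodType) (F : X -> V) (s t : seq X) :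
  uniq s -> uniq t -> (forall x, x \notin s -> F x = 0) ->
  (forall x, x \notin t -> F x = 0) -> \sum_(x <- s) F x = \sum_(x <- t) F x.
Proof.
move=> us ut Fs Ft.
rewrite (bigID (mem t)) [RHS](bigID (mem s)) /=.
rewrite [X in _ + X]big1 ?[X in _ = _ + X]big1 // !addr0.
rewrite -big_filter -[RHS]big_filter; apply: perm_big.
by apply: uniq_perm => [||x]; rewrite ?filter_uniq // !mem_filter andbC.
Qed.

Section FreeModule.
Variable X : choiceType.

(** The free module on X is realized by the finitely supported functions. *)
Definition finite_support : {pred (X -> R^o)} :=
  fun f => `[< exists s : seq X, forall x, x \notin s -> f x = 0 >].

Lemma finite_support_submod : submod_closed finite_support.
Proof.
split=> [|a f g]; rewrite !unfold_in; first by apply/asboolP; exists [::].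
move=> /asboolP[s fs] /asboolP[t gt]; apply/asboolP; exists (s ++ t) => x.
rewrite mem_cat negb_or => /andP[/fs fx /gt gx].
by rewrite !fctE fx gx scaler0 addr0.
Qed.
HB.instance Definition _ := GRing.isSubmodClosed.Build R (X -> R^o)
  finite_support finite_support_submod.

Definition free_on : lmodType R := submod finite_support.

Definition free_coef (x : X) (f : free_on) : R := \val f x.

Lemma free_coefP x a f g :
  free_coef x (a *: f + g) = a * free_coef x f + free_coef x g.
Proof. by []. Qed.

Lemma free_on_support (f : free_on) :
  exists2 s : seq X, uniq s & forall x, x \notin s -> free_coef x f = 0.
Proof.
have /asboolP[s sP] := valP f; exists (undup s); first exact: undup_uniq.
by move=> x; rewrite mem_undup; exact: sP.
Qed.

Lemma free_on_extend (V : lmodType R) (e : X -> V) :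
  exists h : {linear free_on -> V}, forall (f : free_on) s,
    uniq s -> (forall x, x \notin s -> free_coef x f = 0) ->
    h f = \sum_(x <- s) free_coef x f *: e x.
Proof.
have /choice[S SP] : forall f : free_on, exists s : seq X,
    uniq s /\ forall x, x \notin s -> free_coef x f = 0.
  by move=> f; have [s us fs] := free_on_support f; exists s.
pose h f := \sum_(x <- S f) free_coef x f *: e x.
have hE f s : uniq s -> (forall x, x \notin s -> free_coef x f = 0) ->
    h f = \sum_(x <- s) free_coef x f *: e x.
  move=> us fs; have [uS fS] := SP f; apply: sum_support => // x.
    by move=> /fS ->; rewrite scale0r.
  by move=> /fs ->; rewrite scale0r.
have hl : linear h.
  move=> a f g; have [uf fS] := SP f; have [ug gS] := SP g.
  pose s := undup (S f ++ S g).
  have us : uniq s by apply: undup_uniq.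
  have fs x : x \notin s -> free_coef x f = 0.
    by rewrite mem_undup mem_cat negb_or => /andP[/fS].
  have gs x : x \notin s -> free_coef x g = 0.
    by rewrite mem_undup mem_cat negb_or => /andP[_ /gS].
  rewrite (hE _ s us) => [|x xs].
    rewrite (hE f s us fs) (hE g s us gs) scaler_sumr -big_split /=.
    by apply: eq_bigr => x _; rewrite free_coefP scalerDl scalerA.
  by rewrite free_coefP fs // gs // mulr0 addr0.
by have [k kE] := linear_bundle hl; exists k => f s us fs; rewrite kE; exact: hE.
Qed.

Lemma free_on_delta (x : X) :
  exists f : free_on, forall y, free_coef y f = (y == x)%:R.
Proof.
have fs : (fun y => (y == x)%:R : R^o) \in finite_support.
  apply/asboolP; exists [:: x] => y.
  by rewrite inE => /negbTE ->.
by exists (Submod fs).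
Qed.

End FreeModule.

(** The phi x are coordinate functions for the family e at the vector p. *)
Definition expands (P : lmodType R) (X : choiceType) (e : X -> P)
    (phi : X -> {linear P -> R^o}) (p : P) : Prop :=
  exists s : seq X, [/\ uniq s, forall x, x \notin s -> phi x p = 0 &
    p = \sum_(x <- s) (phi x p : R) *: e x].

Definition dual_basis (P : lmodType R) : Prop :=
  exists (X : choiceType) (e : X -> P) (phi : X -> {linear P -> R^o}),
    forall p, expands e phi p.

(** P is a retract of the free module on its own underlying set. *)
Lemma projective_dual_basis (P : lmodType R) : projective P -> dual_basis P.
Proof.
move=> pP; have [h hE] := @free_on_extend P P id.
have hs p : exists f, h f = p.
  have [f fE] := free_on_delta p; exists f.
  rewrite (hE f [:: p]) // => [|x]; last by rewrite inE fE => /negbTE ->.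
  by rewrite big_seq1 fE eqxx scale1r.
have [c cE] := projective_lift idfun pP hs.
have phil (x : P) : linear (fun p => free_coef x (c p) : R^o).
  by move=> a p q; rewrite linearP free_coefP.
have /choice[phi phiE] := fun x => linear_bundle (phil x).
exists P, id, phi => p; have [s us cs] := free_on_support (c p).
exists s; split=> // [x xs|]; first by rewrite phiE cs.
rewrite -[LHS](cE p) (hE _ s us cs).
by apply: eq_bigr => x _; rewrite phiE.
Qed.

Lemma expands_sum (P V : lmodType R) (X : choiceType)
    (phi : X -> {linear P -> R^o}) (v : X -> V) p s t :
  uniq s -> uniq t -> (forall x, x \notin s -> phi x p = 0) ->
  (forall x, x \notin t -> phi x p = 0) ->
  \sum_(x <- s) (phi x p : R) *: v x = \sum_(x <- t) (phi x p : R) *: v x.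
Proof.
move=> us ut ps pt; apply: sum_support => // x.
  by move=> /ps ->; rewrite scale0r.
by move=> /pt ->; rewrite scale0r.
Qed.

Lemma expandsD (P : lmodType R) (X : choiceType) (e : X -> P)
    (phi : X -> {linear P -> R^o}) p q :
  expands e phi p -> expands e phi q -> expands e phi (p + q).
Proof.
move=> [s [us ps pE]] [t [ut qt qE]]; pose r := undup (s ++ t).
have ur : uniq r by apply: undup_uniq.
have pr x : x \notin r -> phi x p = 0.
  by rewrite mem_undup mem_cat negb_or => /andP[/ps].
have qr x : x \notin r -> phi x q = 0.
  by rewrite mem_undup mem_cat negb_or => /andP[_ /qt].
exists r; split=> // [x xr|]; first by rewrite linearD /= pr // qr // addr0.
rewrite {1}pE {1}qE (expands_sum e us ur ps pr) (expands_sum e ut ur qt qr).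
rewrite -big_split /=; apply: eq_bigr => x _.
by rewrite linearD scalerDl.
Qed.

Lemma dual_basis_projective (P : lmodType R) : dual_basis P -> projective P.
Proof.
case=> X [e [phi exP]]; apply: projectiveP => V W g f gs.
have /choice[v vE] := fun x => gs (f (e x)).
have /choice[S SP] := exP.
have hl : linear (fun p => \sum_(x <- S p) (phi x p : R) *: v x).
  move=> a p q.
  pose r := undup (S (a *: p + q) ++ S p ++ S q).
  have ur : uniq r by apply: undup_uniq.
  have rS u : {subset S u <= r} -> \sum_(x <- S u) (phi x u : R) *: v x =
      \sum_(x <- r) (phi x u : R) *: v x.
    move=> sub; have [uS uz _] := SP u; apply: expands_sum => // x xr.
    by apply: uz; apply: contra xr => /sub.
  rewrite !rS => [| | |]; do ?by move=> x xS; rewrite mem_undup !mem_cat xS ?orbT.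
  rewrite scaler_sumr -big_split; apply: eq_bigr => x _ /=.
  by rewrite linearP scalerDl scalerA.
have [h hE] := linear_bundle hl; exists h => p.
have [_ _ pE] := SP p; rewrite hE linear_sum [in RHS]pE linear_sum.
by apply: eq_bigr => x _; rewrite !linearZ /= vE.
Qed.

End DualBasis.

Section TensorMaps.
Variable R : comNzRingType.

Lemma tensor_ind (M N : lmodType R) (Z : tensor M N -> Prop) :
  Z 0 -> (forall x y, Z (tens x y)) -> (forall u v, Z u -> Z v -> Z (u + v)) ->
  forall u, Z u.
Proof.
move=> Z0 Zt ZD u; rewrite -(tensor_sum_repr u) tensor_sumE.
by elim/big_rec: _ => // p v _; apply: ZD.
Qed.

Lemma tensor_linear_ext (M N V : lmodType R) (f g : {linear tensor M N -> V}) :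
  (forall x y, f (tens x y) = g (tens x y)) -> f =1 g.
Proof.
move=> fg; elim/tensor_ind => [|//|u v fu fv]; first by rewrite !raddf0.
by rewrite !raddfD /= fu fv.
Qed.

Lemma tensor_lift (M N V : lmodType R) (b : M -> N -> V) :
  (forall y, linear (b^~ y)) -> (forall x, linear (b x)) ->
  exists g : {linear tensor M N -> V}, forall x y, g (tens x y) = b x y.
Proof.
move=> bl br; have [g [[gl gE] _]] := tensor_universal bl br.
by have [k kE] := linear_bundle gl; exists k => x y; rewrite kE.
Qed.

Section Tens.
Variables M N : lmodType R.

Lemma tens0l (y : N) : tens (0 : M) y = 0.
Proof. by rewrite -(scale0r 0) tensorZl scale0r. Qed.

Lemma tens0r (x : M) : tens x (0 : N) = 0.
Proof. by rewrite -(scale0r 0) tensorZr scale0r. Qed.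

Lemma tens_suml (I : Type) (s : seq I) (F : I -> M) (y : N) :
  tens (\sum_(i <- s) F i) y = \sum_(i <- s) tens (F i) y.
Proof.
by apply: (big_morph (fun x => tens x y)) => [x x'|]; [exact: tensorDl|exact: tens0l].
Qed.

Lemma tens_sumr (I : Type) (s : seq I) (F : I -> N) (x : M) :
  tens x (\sum_(i <- s) F i) = \sum_(i <- s) tens x (F i).
Proof.
by apply: (big_morph (tens x)) => [y y'|]; [exact: tensorDr|exact: tens0r].
Qed.

End Tens.

Section Map.
Variables (M N M' N' : lmodType R).
Variables (f : {linear M -> M'}) (g : {linear N -> N'}).

Lemma tensor_map_exists : exists h : {linear tensor M N -> tensor M' N'},
  forall x y, h (tens x y) = tens (f x) (g y).
Proof.
apply: tensor_lift => [y a x x'|x a y y'].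
  by rewrite linearP tensorDl tensorZl.
by rewrite linearP tensorDr tensorZr.
Qed.

Definition tensor_map : {linear tensor M N -> tensor M' N'} :=
  sval (cid tensor_map_exists).

Lemma tensor_mapE x y : tensor_map (tens x y) = tens (f x) (g y).
Proof. exact: (svalP (cid tensor_map_exists)). Qed.

Hypotheses (fs : forall y, exists x, f x = y) (gs : forall y, exists x, g x = y).

Lemma tensor_map_surj u : exists v, tensor_map v = u.
Proof.
elim/tensor_ind: u => [|x y|u v [u' <-] [v' <-]].
- by exists 0; rewrite raddf0.
- have [x' <-] := fs x; have [y' <-] := gs y.
  by exists (tens x' y'); rewrite tensor_mapE.
- by exists (u' + v'); rewrite raddfD.
Qed.

(** Right exactness of the tensor product in both variables at once: a subgroup
    that contains x (x) y whenever f x = 0 or g y = 0 contains the kernel of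
    f (x) g.  Set-theoretic sections a of f and b of g induce a map S on formal
    sums that respects the tensor congruence modulo Z and inverts f (x) g
    modulo Z. *)
Lemma tensor_map_ker (Z : tensor M N -> Prop) :
  Z 0 -> (forall u v, Z u -> Z v -> Z (u - v)) ->
  (forall x y, f x = 0 -> Z (tens x y)) ->
  (forall x y, g y = 0 -> Z (tens x y)) ->
  forall u, tensor_map u = 0 -> Z u.
Proof.
move=> Z0 ZB Zf Zg.
have ZN u : Z u -> Z (- u) by move=> Zu; rewrite -sub0r; apply: ZB.
have ZD u v : Z u -> Z v -> Z (u + v).
  by move=> Zu /ZN Zv; rewrite -[v]opprK; apply: ZB.
have [a aE] := choice fs; have [b bE] := choice gs.
have tB x x' y : tens x y - tens x' y = tens (x - x') y :> tensor M N.
  by rewrite -[- x']scaleN1r tensorDl tensorZl scaleN1r.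
have tBr x y y' : tens x y - tens x y' = tens x (y - y') :> tensor M N.
  by rewrite -[- y']scaleN1r tensorDr tensorZr scaleN1r.
have tZ x x' y y' : f x = f x' -> g y = g y' -> Z (tens x y - tens x' y').
  move=> fx gy; rewrite -(subrKA (tens x' y)) tB tBr.
  by apply: ZD; [apply: Zf|apply: Zg]; rewrite linearB ?fx ?gy subrr.
pose S (s : seq (M' * N')) : tensor M N := \sum_(p <- s) tens (a p.1) (b p.2).
have S_eq s t : tensor_eq s t -> Z (S s - S t).
  elim=> {s t} [s|s t _|s t u _ Zst _ Ztu|s s' t t' _ Zs _ Zt|s t|y|x x' y
               |x y y'|c x y]; rewrite /S ?big_cat ?big_cons ?big_nil /= ?addr0.
  - by rewrite subrr.
  - by move=> /ZN; rewrite opprB.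
  - by rewrite -(subrKA (S t)); apply: ZD.
  - by rewrite opprD addrACA; apply: ZD.
  - by rewrite addrC subrr.
  - by rewrite subr0; apply: Zf; rewrite aE.
  - rewrite -tensorDl; apply: tZ; rewrite // linearD /= !aE //.
  - by rewrite -tensorDr; apply: tZ; rewrite // linearD /= !bE.
  - rewrite (_ : tens (a x) _ = tens (c *: a x) (b y) + 
      (tens (a x) (b (c *: y)) - tens (a x) (c *: b y))); last first.
      by rewrite tensorZl tensorZr addrC subrK.
    rewrite opprD addrA; apply: ZB; apply: tZ => //.
      by rewrite linearZ /= !aE.
    by rewrite linearZ /= !bE.
move=> u u0; rewrite -[u](subrK (S [seq (f p.1, g p.2) | p <- repr u])).
apply: (ZD).
  rewrite -{1}(tensor_sum_repr u) tensor_sumE /S big_map -sumrB.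
  apply: (big_rec Z) => // p v _ Zv; apply: ZD => //.
  by apply: tZ; rewrite ?aE ?bE.
rewrite -[S _]subr0 -[X in Z (_ - X)](_ : S [::] = 0); last by rewrite /S big_nil.
apply: S_eq; apply/tensor_sumP; rewrite !tensor_sumE big_nil big_map -[RHS]u0.
rewrite -{2}(tensor_sum_repr u) tensor_sumE linear_sum.
by apply: eq_bigr => p _; rewrite /= tensor_mapE.
Qed.

End Map.

Lemma tensor_projective (P Q : lmodType R) :
  projective P -> projective Q -> projective (tensor P Q).
Proof.
move=> /projective_dual_basis[X [e [phi eP]]].
move=> /projective_dual_basis[Y [e' [psi eQ]]].
apply: dual_basis_projective.
have /choice[chi chiE] : forall z : X * Y, exists h : {linear tensor P Q -> R^o},
    forall p q, h (tens p q) = (phi z.1 p : R) * psi z.2 q.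
  move=> [x y]; apply: tensor_lift => /= [q a p p'|p a q q'].
    by rewrite linearP mulrDl -mulrA.
  by rewrite linearP mulrDr mulrCA.
exists (X * Y)%type, (fun z => tens (e z.1) (e' z.2)), chi.
elim/tensor_ind => [|p q|u v]; last exact: expandsD.
  by exists [::]; split=> // [x _|]; rewrite ?raddf0 ?big_nil.
have [s [us ps pE]] := eP p; have [t [ut qt qE]] := eQ q.
exists [seq (x, y) | x <- s, y <- t]; split.
- by apply: allpairs_uniq => // -[x y] [x' y'].
- move=> [x y] xy; rewrite chiE /=.
  have : (x \notin s) || (y \notin t).
    rewrite -negb_and; apply: contra xy => /andP[xs yt].
    by apply/allpairsP; exists (x, y).
  by case/orP=> [/ps|/qt] ->; rewrite ?mul0r ?mulr0.
rewrite big_allpairs [in LHS]pE [in LHS]qE tens_suml; apply: eq_bigr => x _.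
rewrite tens_sumr; apply: eq_bigr => y _.
by rewrite chiE tensorZl tensorZr scalerA.
Qed.

(** A tensor over a projective [P] is determined by its coordinates in a dual
    basis of [P], and a coordinate only sees the second factor. *)
Lemma tensor_projective_inj (P K Q : lmodType R) (i : {linear K -> Q}) :
  projective P -> injective i ->
  injective (tensor_map (idfun : {linear P -> P}) i).
Proof.
move=> /projective_dual_basis[X [e [phi eP]]] ii.
have coord V : exists c : X -> {linear tensor P V -> V},
    forall x p v, c x (tens p v) = (phi x p : R) *: v.
  suff /choice[c cE] : forall x, exists c : {linear tensor P V -> V},
    forall p v, c (tens p v) = (phi x p : R) *: v by exists c.
  move=> x; apply: tensor_lift => [v a p q|p a v w].
    by rewrite linearP scalerDl scalerA.
  by rewrite scalerDr !scalerA mulrC.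
have [cK cKE] := coord K; have [cQ cQE] := coord Q.
have cN x u : i (cK x u) = cQ x (tensor_map idfun i u).
  apply: (@tensor_linear_ext _ _ _ (i \o cK x)
    (cQ x \o tensor_map idfun i)) => p k /=.
  by rewrite cKE tensor_mapE cQE linearZ.
have expand u : exists s0 : seq X, forall s, uniq s -> {subset s0 <= s} ->
    u = \sum_(x <- s) tens (e x) (cK x u).
  elim/tensor_ind: u => [|p k|u v [s su] [t tv]].
  - by exists [::] => s _ _; rewrite big1 // => x _; rewrite raddf0 tens0r.
  - have [s [us ps pE]] := eP p; exists s => t ut st.
    rewrite {1}pE (expands_sum e us ut ps) => [|x xt]; last first.
      by apply: ps; apply: contra xt => /st.
    rewrite tens_suml; apply: eq_bigr => x _.
    by rewrite cKE tensorZl tensorZr.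
  - exists (s ++ t) => r ur sub.
    rewrite {1}(su r) // => [|x xs]; last by apply: sub; rewrite mem_cat xs.
    rewrite {1}(tv r) // => [|x xs]; last by apply: sub; rewrite mem_cat xs orbT.
    by rewrite -big_split; apply: eq_bigr => x _; rewrite linearD tensorDr.
apply: linear_inj0 => u u0.
have [s sP] := expand u.
rewrite (sP (undup s)) ?undup_uniq // => [|x]; last by rewrite mem_undup.
rewrite big1 // => x _; rewrite (_ : cK x u = 0) ?tens0r //.
by apply: ii; rewrite cN u0 !raddf0.
Qed.

Lemma tensor_right_exact_l (K P M N : lmodType R)
    (i : {linear K -> P}) (g : {linear P -> M}) :
  short_exact i g -> forall u : tensor P N,
  tensor_map g idfun u = 0 <-> exists v, tensor_map i idfun v = u.
Proof.
move=> [ii gs ex] u; split=> [|[v <-]]; last first.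
  elim/tensor_ind: v => [|x y|v w]; first by rewrite !raddf0.
    by rewrite !tensor_mapE (_ : g (i x) = 0) ?tens0l //; apply/ex; exists x.
  by rewrite !linearD /= => -> ->; rewrite addr0.
have gi (y : N) : exists x, (idfun : {linear N -> N}) x = y by exists y.
apply: (tensor_map_ker gs gi
  (Z := fun w => exists v, tensor_map i idfun v = w)) => //.
- by exists 0; rewrite raddf0.
- by move=> _ _ [a <-] [b <-]; exists (a - b); rewrite raddfB.
- by move=> x y /ex[k <-]; exists (tens k y); rewrite tensor_mapE.
- by move=> x y /= ->; exists 0; rewrite raddf0 tens0r.
Qed.

Lemma tensor_right_exact_r (K P M N : lmodType R)
    (i : {linear K -> P}) (g : {linear P -> M}) :
  short_exact i g -> forall u : tensor N P,
  tensor_map idfun g u = 0 <-> exists v, tensor_map idfun i v = u.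
Proof.
move=> [ii gs ex] u; split=> [|[v <-]]; last first.
  elim/tensor_ind: v => [|x y|v w]; first by rewrite !raddf0.
    by rewrite !tensor_mapE (_ : g (i y) = 0) ?tens0r //; apply/ex; exists y.
  by rewrite !linearD /= => -> ->; rewrite addr0.
have gi (y : N) : exists x, (idfun : {linear N -> N}) x = y by exists y.
apply: (tensor_map_ker gi gs
  (Z := fun w => exists v, tensor_map idfun i v = w)) => //.
- by exists 0; rewrite raddf0.
- by move=> _ _ [a <-] [b <-]; exists (a - b); rewrite raddfB.
- by move=> x y /= ->; exists 0; rewrite raddf0 tens0l.
- by move=> x y /ex[k <-]; exists (tens x k); rewrite tensor_mapE.
Qed.

Lemma pdle_tensor_projective n (P N : lmodType R) :
  projective P -> pdle n N -> pdle n (tensor P N).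
Proof.
move=> pP; elim: n N => [|n IHn] N /=; first exact: tensor_projective.
case=> K [Q [i [g [ex pQ pK]]]]; case: (ex) => ii gs _.
exists (tensor P K), (tensor P Q), (tensor_map idfun i), (tensor_map idfun g).
split; [split| |]; last exact: IHn.
- exact: tensor_projective_inj.
- by apply: tensor_map_surj => // y; exists y.
- exact: tensor_right_exact_r.
- exact: tensor_projective.
Qed.

End TensorMaps.

(** * Regular sequences and modules of small projective dimension *)

Section RegularSequences.
Variable R : comNzRingType.

(** The element a lies in the submodule y1 N + ... + yk N. *)
Fixpoint in_mul (N : lmodType R) (ys : seq R) (a : N) : Prop :=
  if ys is y :: s then exists b, in_mul s (a - y *: b) else a = 0.

Definition weakly_regular (ys : seq R) (N : lmodType R) : Prop :=
  forall i, (i < size ys)%N -> forall a : N,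
    in_mul (take i ys) (ys`_i *: a) -> in_mul (take i ys) a.

Lemma in_mul_class y ys (N : lmodType R) (u : N) :
  in_mul ys (eltq_class y u) <-> in_mul (y :: ys) u.
Proof.
elim: ys u => [|z s IHs] u /=.
  rewrite eltq_class_eq0; split=> -[w uw]; exists w; first by rewrite uw subrr.
  exact: subr0_eq.
split=> [[q]|[b [v buv]]].
  have [v ->] := eltq_surj q.
  rewrite -eltq_classZ -scaleN1r -eltq_classZ -eltq_classD scaleN1r.
  by move=> /IHs[b /= ub]; exists b, v; rewrite addrAC.
exists (eltq_class y v).
rewrite -eltq_classZ -scaleN1r -eltq_classZ -eltq_classD scaleN1r.
by apply/IHs; exists b; rewrite addrAC.
Qed.

Lemma weakly_regular_cons y ys (N : lmodType R) :
  weakly_regular (y :: ys) N ->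
  (forall a : N, y *: a = 0 -> a = 0) /\ weakly_regular ys (eltq y N).
Proof.
move=> reg; split=> [a|i iys q]; first exact: (reg 0%N).
have [a ->] := eltq_surj q; rewrite -eltq_classZ !in_mul_class.
exact: (reg i.+1).
Qed.

(** Unlike projectivity over R, weak regularity survives reduction modulo the
    first element of the sequence.  Resolutions by such modules can therefore be
    reduced step by step while R remains the base ring. *)
Fixpoint regular_pdle (ys : seq R) (n : nat) (N : lmodType R) : Prop :=
  if n is k.+1 then
    exists (K P : lmodType R) (i : {linear K -> P}) (g : {linear P -> N}),
      [/\ short_exact i g, weakly_regular ys P & regular_pdle ys k K]
  else weakly_regular ys N.

(** The connecting map Tor_1 (R / y, N) -> K / y K vanishes, as y is a
    nonzerodivisor on N. *)
Lemma short_exact_eltq y (K P N : lmodType R)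
    (i : {linear K -> P}) (g : {linear P -> N}) :
  short_exact i g -> (forall a : N, y *: a = 0 -> a = 0) ->
  exists (i' : {linear eltq y K -> eltq y P})
    (g' : {linear eltq y P -> eltq y N}),
    short_exact i' g'.
Proof.
move=> [ii gs ex] yN.
have [i' i'E] := eltq_map y i; have [g' g'E] := eltq_map y g.
exists i', g'; split.
- apply: linear_inj0 => q; have [k ->] := eltq_surj q.
  rewrite i'E => /eltq_class_eq0[p kp]; apply/eltq_class_eq0.
  have /ex[k' k'p] : g p = 0.
    by apply: yN; rewrite -linearZ /= -kp; apply/ex; exists k.
  by exists k'; apply: ii; rewrite kp linearZ /= k'p.
- move=> q; have [c ->] := eltq_surj q; have [b <-] := gs c.
  by exists (eltq_class y b).
move=> q; have [p ->] := eltq_surj q; rewrite g'E.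
split=> [/eltq_class_eq0[m pm]|[r]].
  have [p' p'm] := gs m.
  have /ex[k kE] : g (p - y *: p') = 0.
    by rewrite linearB linearZ /= p'm pm subrr.
  exists (eltq_class y k); rewrite i'E kE; apply/eltq_classP.
  by exists (- p'); rewrite addrAC subrr add0r scalerN.
have [k ->] := eltq_surj r; rewrite i'E => /eltq_classP[w kw].
apply/eltq_class_eq0; exists (- g w).
have -> : p = i k - y *: w by rewrite -kw opprB addrC subrK.
rewrite linearB linearZ /= (_ : g (i k) = 0) ?sub0r ?scalerN //.
by apply/ex; exists k.
Qed.

Lemma short_exact_nonzerodivisor y (K P N : lmodType R)
    (i : {linear K -> P}) (g : {linear P -> N}) :
  short_exact i g -> (forall a : P, y *: a = 0 -> a = 0) ->
  forall a : K, y *: a = 0 -> a = 0.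
Proof.
move=> [ii _ _] yP a ya; apply: ii; rewrite raddf0; apply: yP.
by rewrite -linearZ /= ya raddf0.
Qed.

Lemma regular_pdle_eltq y ys n (N : lmodType R) :
  regular_pdle (y :: ys) n N -> (forall a : N, y *: a = 0 -> a = 0) ->
  regular_pdle ys n (eltq y N).
Proof.
elim: n N => [|n IHn] N; first by move=> /weakly_regular_cons[].
case=> K [P [i [g [ex /weakly_regular_cons[yP rP] pK]]]] yN.
have [i' [g' ex']] := short_exact_eltq ex yN.
exists (eltq y K), (eltq y P), i', g'; split=> //.
by apply: IHn => //; apply: short_exact_nonzerodivisor ex yP.
Qed.

(** Lift z to u in P.  The elements y u, for y in the sequence, lie in K, and
    the class of y1 u in K / y1 K is killed by the rest of the sequence, since
    y (y1 u) = y1 (y u).  By induction that class is zero: y1 u = y1 c with c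
    in K, so u = c and z = 0. *)
Lemma regular_pdle_socle ys n (N : lmodType R) :
  regular_pdle ys n N -> (n < size ys)%N ->
  forall z : N, (forall y, y \in ys -> y *: z = 0) -> z = 0.
Proof.
elim: n ys N => [|n IHn] [|y s] N //.
  move=> /weakly_regular_cons[yN _] _ z zs; apply: yN; apply: zs.
  exact: mem_head.
case=> K [P [i [g [ex rP pK]]]] ns z zs.
have [yP _] := weakly_regular_cons rP.
have yK := short_exact_nonzerodivisor ex yP.
case: ex => ii gs ex.
have [u uz] := gs z.
have zi w : w \in y :: s -> exists a, i a = w *: u.
  by move=> ws; apply/ex; rewrite linearZ /= uz zs.
have [a aE] := zi y (mem_head _ _).
have : eltq_class y a = 0.
  apply: (IHn s) => // [|w ws]; first exact: regular_pdle_eltq.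
  rewrite -eltq_classZ; apply/eltq_class_eq0.
  have [b bE] : exists b, i b = w *: u by apply: zi; rewrite inE ws orbT.
  by exists b; apply: ii; rewrite !linearZ /= aE bE !scalerA mulrC.
move=> /eltq_class_eq0[c ac].
have /eqP := aE; rewrite ac linearZ -subr_eq0 /= -scalerBr => /eqP/yP.
by move=> /subr0_eq uc; rewrite -uz -uc; apply/ex; exists c.
Qed.

Lemma in_mul_linear (N N' : lmodType R) (f : {linear N -> N'}) ys a :
  in_mul ys a -> in_mul ys (f a).
Proof.
elim: ys a => [|y s IHs] a /=; first by move=> ->; rewrite raddf0.
by move=> [b /IHs]; rewrite linearB linearZ /=; exists (f b).
Qed.

Lemma in_mul0 (N : lmodType R) ys : in_mul ys (0 : N).
Proof. by elim: ys => //= y s IHs; exists 0; rewrite scaler0 subr0. Qed.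

Lemma in_mulD (N : lmodType R) ys (a b : N) :
  in_mul ys a -> in_mul ys b -> in_mul ys (a + b).
Proof.
elim: ys a b => [|y s IHs] a b /=; first by move=> -> ->; rewrite addr0.
move=> [a' ha] [b' hb]; exists (a' + b').
by rewrite scalerDr opprD addrACA; apply: IHs.
Qed.

Lemma in_mul_span ys (x : R) : in_mul ys (x : R^o) <-> in_span (V := R^o) ys x.
Proof.
elim: ys x => [|y s IHs] x /=.
  split=> [->|[c ->]]; last by rewrite big_ord0.
  by exists (fun=> 0); rewrite big_ord0.
split=> [[b /IHs[c xE]]|[c xE]].
  exists (fun i => if i is k.+1 then c k else b).
  rewrite big_ord_recl /= -[LHS](subrK (y *: (b : R^o))) xE addrC.
  by congr (_ + _); rewrite /GRing.scale /= mulrC.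
exists (c 0%N); apply/IHs; exists (fun i => c i.+1).
rewrite xE big_ord_recl /= addrAC -[X in _ = X]add0r; congr (_ + _).
by rewrite /GRing.scale /= mulrC subrr.
Qed.

(** Membership in y1 P + ... + yk P is tested on the coordinates in a dual
    basis. *)
Lemma projective_weakly_regular ys (P : lmodType R) :
  regular_sequence ys -> projective P -> weakly_regular ys P.
Proof.
move=> [reg _] /projective_dual_basis[X [e [phi eP]]] i iys p ip.
have [s [_ _ ->]] := eP p.
elim/big_rec: _ => [|x q _ qi]; first exact: in_mul0.
apply: in_mulD => //.
have fl : linear (fun c : R^o => (c : R) *: e x).
  by move=> a c c'; rewrite scalerDl scalerA.
have [f fE] := linear_bundle fl; rewrite -fE; apply: in_mul_linear.
apply/in_mul_span/reg => //; apply/in_mul_span.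
by have := in_mul_linear (phi x) ip; rewrite linearZ.
Qed.

Lemma pdle_regular ys n (N : lmodType R) :
  regular_sequence ys -> pdle n N -> regular_pdle ys n N.
Proof.
move=> reg; elim: n N => [|n IHn] N /=; first exact: projective_weakly_regular.
case=> K [P [i [g [ex pP /IHn pK]]]]; exists K, P, i, g; split=> //.
exact: projective_weakly_regular.
Qed.

(** Multiply z by the largest power of each y in turn that does not kill it. *)
Lemma nilpotent_socle (ys : seq R) (N : lmodType R) (z : N) : z != 0 ->
  (forall y, y \in ys -> exists t, y ^+ t *: z = 0) ->
  exists c : R, c *: z != 0 /\ forall y, y \in ys -> y *: (c *: z) = 0.
Proof.
move=> z0; elim: ys => [|y s IHs] ysz; first by exists 1; rewrite scale1r.
have [|c [cz cs]] := IHs; first by move=> w ws; apply: ysz; rewrite inE ws orbT.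
have [t yt] := ysz y (mem_head _ _).
have ex : exists t, y ^+ t *: (c *: z) == 0.
  by exists t; rewrite scalerA mulrC -scalerA yt scaler0.
case: (ex_minnP ex) => -[|k] /eqP kz kmin.
  by move: cz; rewrite -[_ *: _]scale1r kz eqxx.
exists (y ^+ k * c); rewrite -scalerA; split.
  by apply/negP => /kmin; rewrite ltnn.
move=> w; rewrite inE => /orP[/eqP ->|ws]; first by rewrite scalerA -exprS.
by rewrite scalerA mulrC -scalerA cs // scaler0.
Qed.

Lemma pdle_torsion_free ys n (N : lmodType R) :
  regular_sequence ys -> pdle n N -> (n < size ys)%N ->
  forall z : N, (forall y, y \in ys -> exists t, y ^+ t *: z = 0) -> z = 0.
Proof.
move=> reg pN nys z zt; apply/eqP/negPn/negP => z0.
have [c [cz cs]] := nilpotent_socle z0 zt.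
by move/eqP: cz; apply; apply: (regular_pdle_socle (pdle_regular reg pN) nys).
Qed.

End RegularSequences.

(** * Factoring multiplication by a scalar through a projective module *)

Section SplitBy.
Variable R : comNzRingType.

(** Multiplication by s on M factors through every surjection onto M;
    equivalently s annihilates Ext^1 (M, -). *)
Definition split_by (s : R) (M : lmodType R) : Prop :=
  forall (V : lmodType R) (g : {linear V -> M}), (forall x, exists v, g v = x) ->
    exists h : {linear M -> V}, forall x, g (h x) = s *: x.

Lemma split_by_projective s (P M : lmodType R) (g : {linear P -> M}) :
  projective P ->
  (exists h : {linear M -> P}, forall x, g (h x) = s *: x) -> split_by s M.
Proof.
move=> pP [h hE] V k ks; have [l lE] := projective_lift g pP ks.
by exists (l \o h) => x /=; rewrite lE hE.
Qed.

(** The difference of s . id_P and the composite P -> M -> P takes values in K. *)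
Lemma split_by_retract s (K P M : lmodType R)
    (i : {linear K -> P}) (g : {linear P -> M}) :
  short_exact i g -> split_by s M ->
  exists r : {linear P -> K}, forall x, r (i x) = s *: x.
Proof.
move=> [ii gs ex] sM; have [h hE] := sM P g gs.
have fl : linear (fun p => s *: p - h (g p)).
  by move=> a x y; rewrite !linearP /= addrACA !scalerA mulrC.
have [f fE] := linear_bundle fl.
have [r rE] : exists r : {linear P -> K}, forall p, i (r p) = f p.
  apply: linear_factor_inj => // p; apply/ex; rewrite fE linearB linearZ /=.
  by rewrite hE subrr.
exists r => x; apply: ii; rewrite rE fE linearZ /= (_ : g (i x) = 0).
  by rewrite raddf0 subr0.
by apply/ex; exists x.
Qed.

Lemma split_by_syzygy s (K P M : lmodType R)
    (i : {linear K -> P}) (g : {linear P -> M}) :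
  short_exact i g -> projective P -> split_by s M -> split_by s K.
Proof.
move=> ex pP sM V k ks.
have [r rE] := split_by_retract ex sM.
have [l lE] := projective_lift r pP ks.
by exists (l \o i) => x /=; rewrite lE rE.
Qed.

(** The kernel of K (x) N -> P (x) N is killed by powers of the elements of the
    regular sequence, while K (x) N has projective dimension smaller than the
    length of that sequence. *)
Theorem pdle_tensor ys a b (M N : lmodType R) :
  regular_sequence ys ->
  (forall y, y \in ys -> exists t, split_by (y ^+ t) M) ->
  pdle a M -> pdle b N -> (a + b <= size ys)%N -> pdle (a + b) (tensor M N).
Proof.
move=> reg; elim: a M => [|a IHa] M sM.
  by move=> pM pN _; exact: pdle_tensor_projective.
case=> K [P [i [g [ex pP pK]]]] pN abs.
have sK y : y \in ys -> exists t, split_by (y ^+ t) K.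
  by move=> /sM[t sMt]; exists t; apply: split_by_syzygy ex pP sMt.
have pKN : pdle (a + b) (tensor K N) by apply: IHa => //; apply: ltnW.
have pPN : pdle (a + b).+1 (tensor P N).
  by apply: pdle_leq (pdle_tensor_projective pP pN); rewrite leqW // leq_addl.
rewrite addSn; apply: (pdle_cokernel (i := tensor_map i idfun)
  (g := tensor_map g idfun) _ pKN pPN); split.
- apply: linear_inj0 => u iu.
  apply: (pdle_torsion_free reg pKN abs) => y /sM[t sMt]; exists t.
  have [r rE] := split_by_retract ex sMt.
  have sl : linear (fun w : tensor K N => y ^+ t *: w).
    by move=> c v w; rewrite scalerDr !scalerA mulrC.
  have [f fE] := linear_bundle sl; rewrite -fE.
  rewrite -(@tensor_linear_ext _ _ _ _
    (tensor_map r idfun \o tensor_map i idfun) f) /= ?iu ?raddf0 // => x n.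
  by rewrite !tensor_mapE rE fE /= tensorZl.
- case: ex => _ gs _; apply: tensor_map_surj => // y; by exists y.
- exact: tensor_right_exact_l.
Qed.

End SplitBy.

(** * Ideals of a Noetherian ring *)

Section Primes.
Variable R : comNzRingType.

Definition is_ideal (I : R -> Prop) : Prop :=
  [/\ I 0, forall a b, I a -> I b -> I (a + b) & forall r a, I a -> I (r * a)].

Lemma is_ideal_closed (I : R -> Prop) : is_ideal I -> ~ I 1 ->
  idealr_closed (fun a => `[< I a >]).
Proof.
move=> [I0 ID IM] I1; split=> [||r a b]; rewrite ?unfold_in.
- exact/asboolP.
- by apply/negP => /asboolP.
- by move=> /asboolP Ia /asboolP Ib; apply/asboolP/ID => //; apply: IM.
Qed.

Lemma idealr_bundle (I : R -> Prop) : is_ideal I -> ~ I 1 ->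
  exists p : idealr R, forall a, a \in p <-> I a.
Proof.
move=> Ii I1; pose S (a : R) := `[< I a >].
pose p : idealr R := HB.pack S (isIdealr.Build R S (is_ideal_closed Ii I1)).
by exists p => a; split=> /asboolP.
Qed.

Lemma prime_idealr_bundle (I : R -> Prop) : is_ideal I -> ~ I 1 ->
  (forall a b, I (a * b) -> I a \/ I b) ->
  exists p : prime_idealr R, forall a, a \in p <-> I a.
Proof.
move=> Ii I1 IP; pose S (a : R) := `[< I a >].
have Sp : prime_idealr_closed S.
  move=> a b; rewrite !unfold_in => /asboolP/IP[Ia|Ib]; apply/orP.
    by left; apply/asboolP.
  by right; apply/asboolP.
pose p : prime_idealr R := HB.pack S
  (isIdealr.Build R S (is_ideal_closed Ii I1)) (isPrimeIdealrClosed.Build R S Sp).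
by exists p => a; split=> /asboolP.
Qed.

(** A maximal element among the ideals that contain I and no power of x is
    prime. *)
Lemma prime_avoiding_powers (I : R -> Prop) (x : R) : is_ideal I ->
  (forall t, ~ I (x ^+ t)) ->
  exists p : prime_idealr R, (forall a, I a -> a \in p) /\ x \notin p.
Proof.
move=> [I0 ID IM] Ix.
(* Goodness is imposed on the union of J and I rather than on J, so that the
   union of the empty chain is good. *)
pose good (J : set R) := is_ideal (fun a => J a \/ I a) /\
  forall t, ~ (J (x ^+ t) \/ I (x ^+ t)).
have [F Fgood Ftot|A [[[_ AD AM] Ax] Amax]] := @Zorn_bigcup R good.
  split; last first.
    move=> t [[X FX Xt]|/Ix //]; have [_ /(_ t)] := Fgood _ FX.
    by apply; left.
  split; first by right.
    have XD X a b : F X -> X a \/ I a -> X b \/ I b ->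
        (\bigcup_(X in F) X)%classic (a + b) \/ I (a + b).
      move=> FX Xa Xb; have [[_ /(_ _ _ Xa Xb) Xab _] _] := Fgood _ FX.
      by case: Xab => [Xab|]; [left; exists X|right].
    move=> a b [[X FX Xa]|Ia] [[Y FY Yb]|Ib].
    - have [XY|YX] := Ftot _ _ FX FY.
        by apply: (XD Y) => //; left=> //; apply: XY.
      by apply: (XD X) => //; left=> //; apply: YX.
    - by apply: (XD X) => //; [left|right].
    - by apply: (XD Y) => //; [right|left].
    - by right; apply: ID.
  move=> r a [[X FX Xa]|Ia]; last by right; apply: IM.
  have [[_ _ /(_ r a) XM] _] := Fgood _ FX.
  by case: XM => [|Xra|]; [left|left; exists X|right].
pose A' a := A a \/ I a.
have A'i : is_ideal A' by split=> //; right.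
have power u : ~ A' u -> exists t r a, A' a /\ x ^+ t = a + r * u.
  move=> Au; pose B : set R := fun b => exists r a, A' a /\ b = a + r * u.
  have AB b : A' b -> B b by move=> A'b; exists 0, b; rewrite mul0r addr0.
  have IB b : B b \/ I b -> B b by case=> // Ib; apply: AB; right.
  apply: contrapT => nB; apply: (Amax B).
    split; first by move=> b Ab; apply: AB; left.
    move=> BA; apply: Au; left; apply: BA.
    by exists 1, 0; rewrite mul1r add0r; split=> //; right.
  split; last first.
    by move=> t /IB[r [a [Aa xt]]]; apply: nB; exists t, r, a.
  split; first by left; apply: AB; right.
    move=> b c /IB[r [a [Aa ->]]] /IB[r' [a' [Aa' ->]]]; left.
    exists (r + r'), (a + a'); split; first exact: AD.
    by rewrite mulrDl addrACA.
  move=> s b /IB[r [a [Aa ->]]]; left; exists (s * r), (s * a).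
  by split; [exact: AM|rewrite mulrDr mulrA].
have [|||p pE] := @prime_idealr_bundle A' => //.
- by have := Ax 0%N; rewrite expr0.
- move=> u v Auv; apply: contrapT => /not_orP[/power[t [r [a [Aa xt]]]]].
  move=> /power[t' [r' [a' [Aa' xt']]]]; apply: (Ax (t + t')%N).
  rewrite exprD xt xt'.
  have -> : (a + r * u) * (a' + r' * v) =
    (a' + r' * v) * a + ((r * u) * a' + (r * r') * (u * v)) by ring.
  by apply: (AD); [apply: (AM)|apply: (AD); apply: (AM)].
exists p; split=> [a Ia|]; first by apply/pE; right.
by apply/negP => /pE; have := Ax 1%N; rewrite expr1.
Qed.

End Primes.

Section NoetherianRelations.
Variables (R : comNzRingType) (noethR : noetherian R).

Lemma noetherian_ideal (I : R -> Prop) : is_ideal I ->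
  exists s : seq R, forall x, I x <-> in_span (V := R^o) s x.
Proof.
move=> Ii; have [I1|nI1] := pselect (I 1).
  exists [:: 1] => x; split=> _.
    by exists (fun=> x); rewrite big_ord_recl big_ord0 addr0 /GRing.scale /= mulr1.
  by have [_ _ IM] := Ii; rewrite -[x]mulr1; apply: IM.
have [p pE] := idealr_bundle Ii nI1; have [s sP] := noethR p.
by exists s => x; rewrite -pE.
Qed.

(** Submodules of R^n are finitely generated.  Vectors are sequences of which
    only the first n entries matter; S is a submodule, and the induction
    separates the ideal of its last entries from its vectors with last entry
    zero. *)
Lemma noetherian_vectors n (S : (nat -> R) -> Prop) :
  (forall a c d, S c -> S d -> S (fun i => a * c i + d i)) -> S (fun=> 0) ->
  exists G : seq (nat -> R), (forall j, (j < size G)%N -> S (nth (fun=> 0) G j)) /\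
    forall c, S c -> exists d : nat -> R, forall i, (i < n)%N ->
      c i = \sum_(j < size G) d j * nth (fun=> 0) G j i.
Proof.
elim: n S => [|n IHn] S SP S0; first by exists [::]; split=> // c _; exists (fun=> 0).
have [|s sE] := @noetherian_ideal (fun a => exists2 c, S c & c n = a).
  split; first by exists (fun=> 0).
    move=> _ _ [c Sc <-] [d Sd <-].
    by exists (fun i => 1 * c i + d i); [exact: SP|rewrite mul1r].
  move=> r _ [c Sc <-].
  by exists (fun i => r * c i + 0); [exact: SP|rewrite addr0].
have [||G0 [G0S G0E]] := IHn (fun c => S c /\ c n = 0); last first.
  have /choice[f fE] : forall i, exists c, (i < size s)%N -> S c /\ c n = s`_i.
    move=> i; have [ilt|] := ltnP i (size s); last by exists (fun=> 0).
    have /sE[c Sc cn] : in_span (V := R^o) s s`_i.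
      exists (fun j => (j == i)%:R); rewrite (bigD1 (Ordinal ilt)) //= eqxx.
      rewrite scale1r big1 ?addr0 // => j /eqP ji.
      by case: eqP => [e|]; rewrite ?scale0r //; case: ji; apply: val_inj.
    by exists c.
  (* The vectors f i lift the generators of the ideal of last entries, and G0
     generates the vectors of S with last entry zero. *)
  exists (mkseq f (size s) ++ G0); split.
    move=> j; rewrite nth_cat size_cat size_mkseq => jlt.
    case: ltnP => js; first by rewrite nth_mkseq //; case: (fE j js).
    by have [|//] := G0S (j - size s)%N; rewrite ltn_subLR.
  move=> c Sc; have /sE[a aE] : exists2 c', S c' & c' n = c n by exists c.
  pose e i := c i - \sum_(j < size s) a j * f j i.
  have Se : S e.
    have Sf k : (k <= size s)%N -> S (fun i => \sum_(j < k) a j * f j i).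
      elim: k => [_|k IHk klt].
        by rewrite (_ : (fun _ => _) = fun=> 0) //; apply/funext => i; rewrite big_ord0.
      rewrite (_ : (fun _ => _) = fun i => a k * f k i + \sum_(j < k) a j * f j i).
        by apply: SP; [case: (fE k klt)|apply: IHk; apply: ltnW].
      by apply/funext => i; rewrite big_ord_recr addrC.
    rewrite (_ : e = fun i => -1 * (\sum_(j < size s) a j * f j i) + c i).
      by apply: SP => //; apply: Sf.
    by apply/funext => i; rewrite mulN1r addrC.
  have en : e n = 0.
    rewrite /e aE -sumrB big1 // => j _.
    by have [_ ->] := fE j (ltn_ord j); rewrite subrr.
  have [d dE] := G0E e (conj Se en).
  exists (fun j => if (j < size s)%N then a j else d (j - size s)%N) => i ilt.
  rewrite size_cat size_mkseq big_split_ord /=.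
  rewrite -[c i](subrK (\sum_(j < size s) a j * f j i)) [LHS]addrC; congr (_ + _).
    by apply: eq_bigr => j _; rewrite ltn_ord nth_cat size_mkseq ltn_ord nth_mkseq.
  rewrite -/(e i); transitivity (\sum_(j < size G0) d j * nth (fun=> 0) G0 j i).
    move: ilt; rewrite ltnS leq_eqVlt => /orP[/eqP ->|/dE //].
    rewrite en big1 // => j _.
    by have [_ ->] := G0S j (ltn_ord j); rewrite mulr0.
  apply: eq_bigr => j _.
  by rewrite nth_cat size_mkseq ltnNge leq_addr /= addKn.
- by [].
- move=> a c d [Sc cn] [Sd dn]; split; first exact: SP.
  by rewrite cn dn mulr0 addr0.
Qed.

End NoetherianRelations.

(** * From freeness at a prime to a splitting *)

(** The coefficients of repeated vectors are added up. *)
Lemma in_span_coefficients (A : pzRingType) (V : lmodType A) (s : seq V) (x : V) :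
  in_span s x -> exists c : V -> A, forall E : seq V, uniq E -> {subset s <= E} ->
    x = \sum_(e <- E) c e *: e.
Proof.
case=> c xE; exists (fun e => \sum_(j < size s | s`_j == e) c j) => E uE sE.
transitivity (\sum_(e <- E) \sum_(j < size s) (if s`_j == e then c j *: e else 0)).
  rewrite exchange_big xE; apply: eq_bigr => j _ /=.
  rewrite (bigD1_seq s`_j) //= ?eqxx; last by apply: sE; apply: mem_nth.
  by rewrite big1 ?addr0 // => e /negbTE; rewrite eq_sym => ->.
by apply: eq_bigr => e _; rewrite -big_mkcond scaler_suml.
Qed.

Section LocalizedModules.
Variables (R : comNzRingType) (p : prime_idealr R).

Lemma frac_eq_denom (V : lmodType R) (x y : V) (s t : denom p) :
  dval s = dval t -> x = y -> frac x s = frac y t.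
Proof. by move=> st ->; apply/fracP; exists (denom1 p); rewrite st. Qed.

Lemma frac_eq0 (V : lmodType R) (x : V) (s : denom p) :
  frac x s = 0 <-> exists u : denom p, dval u *: x = 0.
Proof.
split=> [/fracP[u]|[u ux]].
  by rewrite scaler0 /= mulr1 => ux; exists u.
by apply/fracP; exists u; rewrite scaler0 /= mulr1.
Qed.

Lemma fracD (V : lmodType R) (x y : V) (s : denom p) :
  frac x s + frac y s = frac (x + y) s.
Proof.
rewrite frac_addE -scalerDr -[RHS](frac_scale s).
exact: frac_eq_denom.
Qed.

Lemma frac_linear_sum (V : lmodType R) (s : denom p) k (c : nat -> R)
    (x : nat -> V) :
  \sum_(i < k) (loc_frac (c i) (denom1 p) : loc_ring p) *: frac (x i) s =
  frac (\sum_(i < k) c i *: x i) s.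
Proof.
elim: k => [|k IHk].
  by rewrite !big_ord0; apply/esym/frac_eq0; exists (denom1 p); rewrite scaler0.
rewrite !big_ord_recr /= IHk [_ *: _]loc_scaleE.
rewrite -fracD; congr (_ + _).
by apply: frac_eq_denom; rewrite //= mul1r.
Qed.

Lemma common_denominator (V : lmodType R) (v : nat -> localization p V) k :
  exists (s : denom p) (x : nat -> V),
    forall i, (i < k)%N -> v i = frac (x i) s.
Proof.
elim: k => [|k [s [x xE]]]; first by exists (denom1 p), (fun=> 0).
have [y [t yE]] := frac_surj (v k).
exists (denomM s t), (fun i => if i == k then dval s *: y else dval t *: x i).
move=> i; rewrite ltnS leq_eqVlt => /orP[/eqP ->|ik].
  by rewrite eqxx frac_scale.
rewrite (ltn_eqF ik) xE // -[LHS](frac_scale t).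
by apply: frac_eq_denom; rewrite //= mulrC.
Qed.

Lemma common_annihilator k (T : nat -> R -> Prop) :
  (forall i a b, T i a -> T i (a * b)) ->
  (forall i, (i < k)%N -> exists u : denom p, T i (dval u)) ->
  exists u : denom p, forall i, (i < k)%N -> T i (dval u).
Proof.
move=> TM; elim: k => [|k IHk] Tu; first by exists (denom1 p).
have [|u uT] := IHk; first by move=> i ik; apply: Tu; apply: ltnW.
have [w wT] := Tu k (leqnn _).
exists (denomM w u) => i; rewrite ltnS leq_eqVlt => /orP[/eqP ->|ik].
  exact: TM.
by rewrite /= mulrC; apply: TM; apply: uT.
Qed.

Section LocalizedMap.
Variables (V W : lmodType R) (f : {linear V -> W}).

Definition loc_map (v : localization p V) : localization p W :=
  frac (f (repr v).1) (repr v).2.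

Lemma loc_mapE x s : loc_map (frac x s) = frac (f x) s.
Proof.
rewrite /loc_map; have [u uE] := frac_repr x s; apply/fracP; exists u.
by rewrite -!linearZ uE.
Qed.

Lemma loc_map_linear : linear loc_map.
Proof.
move=> a v w; have [b [s ->]] := loc_frac_surj a.
have [x [t ->]] := frac_surj v; have [y [r ->]] := frac_surj w.
rewrite [X in loc_map (X + _)]loc_scaleE frac_addE !loc_mapE.
by rewrite [X in _ = X + _]loc_scaleE frac_addE linearD !linearZ /= !scalerA [b * _]mulrC.
Qed.

End LocalizedMap.

Hypothesis noethR : noetherian R.

(** Over the free module M_p the map P_p -> M_p has a section.  On the finitely
    many generators of M it takes values with a common denominator s.  The
    relations between the generators are finitely generated, so one further
    denominator u makes them hold in P itself and not only in P_p; a third one,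
    w, turns the identity g h = s . id of M_p into one of M. *)
Lemma free_localization_split (P M : lmodType R) (g : {linear P -> M}) :
  (forall x, exists v, g v = x) -> finitely_generated M ->
  free_module (localization p M : lmodType (loc_ring p)) ->
  exists s : denom p, exists h : {linear M -> P}, forall x, g (h x) = dval s *: x.
Proof.
move=> gs [ms msP] [B [Bspan Bfree]].
pose k := size ms; pose l i : localization p M := frac ms`_i (denom1 p).
have [gp gpE] := linear_bundle (loc_map_linear g).
have /choice[S SP] : forall i, exists s : seq (localization p M),
    ([set` s] `<=` B)%classic /\ in_span s (l i).
  by move=> i; have [s sB ls] := Bspan (l i); exists s.
have /choice[C CE] := fun i => in_span_coefficients (SP i).2.
pose E := undup (flatten (mkseq S k)).
have uE : uniq E := undup_uniq _.
have EB : ([set` E] `<=` B)%classic.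
  move=> e /=; rewrite mem_undup => /flatten_mapP[i _ eS].
  by have [SB _] := SP i; apply: SB.
have SE i : (i < k)%N -> {subset S i <= E}.
  move=> ik e eS; rewrite mem_undup; apply/flatten_mapP.
  by exists i; rewrite // mem_iota.
have /choice[q qE] : forall e, exists v, gp v = e.
  move=> e; have [x [s ->]] := frac_surj e; have [v <-] := gs x.
  by exists (frac v s); rewrite gpE loc_mapE.
pose vh i := \sum_(e <- E) C i e *: q e.
have gvh i : (i < k)%N -> gp (vh i) = l i.
  move=> ik; rewrite linear_sum (CE i E uE (SE i ik)).
  by apply: eq_bigr => e _; rewrite linearZ /= qE.
(* Freeness of M_p enters here: relations between the generators of M hold
   between their lifts vh, because they hold coefficientwise in the basis. *)
have rel (c : nat -> R) : \sum_(i < k) c i *: ms`_i = 0 ->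
    \sum_(i < k) (loc_frac (c i) (denom1 p) : loc_ring p) *: vh i = 0.
  move=> c0.
  pose D e := \sum_(i < k) (loc_frac (c i) (denom1 p) : loc_ring p) * C i e.
  have D0 e : e \in E -> D e = 0.
    apply: (Bfree E uE EB).
    transitivity (\sum_(i < k) (loc_frac (c i) (denom1 p) : loc_ring p) *: l i).
      under eq_bigr do rewrite scaler_suml.
      rewrite exchange_big; apply: eq_bigr => i _ /=.
      rewrite (CE i E uE (SE i (ltn_ord i))) scaler_sumr.
      by apply: eq_bigr => e' _; rewrite scalerA.
    rewrite (frac_linear_sum (denom1 p) k c (fun i => ms`_i)) c0.
    by apply/frac_eq0; exists (denom1 p); rewrite scaler0.
  under eq_bigr do rewrite scaler_sumr.
  rewrite exchange_big big1_seq // => e /andP[_ eE].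
  transitivity (D e *: q e); last by rewrite D0 ?scale0r.
  by rewrite scaler_suml; apply: eq_bigr => i _; rewrite scalerA.
have [s [v vE]] := common_denominator vh k.
pose rels (c : nat -> R) := \sum_(i < k) c i *: ms`_i = 0.
have [||G [GS GE]] := noetherian_vectors noethR k (S := rels).
- move=> a c d rc rd; rewrite /rels.
  under eq_bigr do rewrite scalerDl -scalerA.
  by rewrite big_split /= -scaler_sumr rc rd scaler0 addr0.
- by rewrite /rels big1 // => i _; rewrite scale0r.
have [||u uE'] := @common_annihilator (size G) (fun j a =>
    a *: (\sum_(i < k) nth (fun=> 0) G j i *: v i) = 0).
- by move=> j a b ab; rewrite mulrC -scalerA ab scaler0.
- move=> j jG; have := rel _ (GS j jG).
  under eq_bigr do rewrite vE //.
  by rewrite frac_linear_sum => /frac_eq0.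
have urel c : rels c -> dval u *: (\sum_(i < k) c i *: v i) = 0.
  move=> /GE[d dE].
  under eq_bigr do rewrite dE // scaler_suml.
  rewrite exchange_big scaler_sumr big1 // => j _ /=.
  under eq_bigr do rewrite -scalerA.
  by rewrite -scaler_sumr scalerA mulrC -scalerA uE' // scaler0.
have [||w wE] := @common_annihilator k (fun i a =>
    a *: (g (v i) - dval s *: ms`_i) = 0).
- by move=> j a b ab; rewrite mulrC -scalerA ab scaler0.
- move=> i ik; have := gvh i ik; rewrite gpE vE // loc_mapE => /fracP[w].
  by rewrite /= mulr1 -!scalerA => /eqP; rewrite -subr_eq0 -scalerBr => /eqP; exists w.
have /choice[c cE] := msP.
pose uw := dval u * dval w.
(* The choice c x of coordinates of x is immaterial, by urel. *)
pose h x := uw *: \sum_(i < k) c x i *: v i.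
have hE x (d : nat -> R) : x = \sum_(i < k) d i *: ms`_i ->
    h x = uw *: \sum_(i < k) d i *: v i.
  move=> xd; apply/eqP; rewrite -subr_eq0 -scalerBr -sumrB.
  rewrite /uw mulrC -scalerA; under eq_bigr do rewrite -scalerBl.
  rewrite (urel (fun i => c x i - d i)) ?scaler0 //.
  rewrite /rels; under eq_bigr do rewrite scalerBl.
  by rewrite sumrB -xd -cE subrr.
have hl : linear h.
  move=> a x y; rewrite (hE _ (fun i => a * c x i + c y i)).
    under eq_bigr do rewrite scalerDl -scalerA.
    by rewrite big_split /= -scaler_sumr scalerDr !scalerA mulrC.
  under eq_bigr do rewrite scalerDl -scalerA.
  by rewrite big_split /= -scaler_sumr -!cE.
have [h' h'E] := linear_bundle hl.
exists (denomM (denomM u w) s), h' => x.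
rewrite h'E /h linearZ linear_sum /= [in RHS](cE x) -/uw !scaler_sumr.
apply: eq_bigr => i _; rewrite linearZ /=.
have wv : dval w *: g (v i) = dval w *: (dval s *: ms`_i).
  by apply/eqP; rewrite -subr_eq0 -scalerBr wE.
have -> : uw *: (c x i *: g (v i)) = (dval u * c x i) *: (dval w *: g (v i)).
  by rewrite /uw !scalerA; congr (_ *: _); ring.
by rewrite wv /uw !scalerA; congr (_ *: _); ring.
Qed.

End LocalizedModules.

(** The scalars s for which s . id_M factors through g form an ideal.  A prime p
    that contains it and avoids x differs from m, and then freeness of M at p
    yields such a scalar outside p. *)
Lemma locally_free_split_by (R : comNzRingType) (m : idealr R)
    (P M : lmodType R) (g : {linear P -> M}) (x : R) :
  noetherian R -> finitely_generated M ->
  locally_free_on_punctured_spectrum m M ->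
  projective P -> (forall y, exists v, g v = y) ->
  x \in m -> exists t, split_by (x ^+ t) M.
Proof.
move=> noethR fgM lfM pP gs xm.
pose I (s : R) := exists h : {linear M -> P}, forall y, g (h y) = s *: y.
suff [t /(split_by_projective pP)] : exists t, I (x ^+ t) by exists t.
apply: contrapT => nI.
have Ii : is_ideal I.
  split.
  - by exists \0 => y; rewrite raddf0 scale0r.
  - move=> a b [h hE] [k kE]; exists (h \+ k) => y.
    by rewrite raddfD /= hE kE scalerDl.
  - move=> r a [h hE].
    have rl : linear (fun y => r *: h y).
      by move=> c y z; rewrite linearP scalerDr !scalerA mulrC.
    have [k kE] := linear_bundle rl; exists k => y.
    by rewrite kE linearZ /= hE scalerA.
have [|p [Ip xp]] := @prime_avoiding_powers R I x Ii.
  by move=> t It; apply: nI; exists t.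
have [|s [h hE]] := free_localization_split (p := p) noethR gs fgM.
  by apply: lfM => pm; rewrite -pm (negbTE xp) in xm.
by have := dvalP s; rewrite Ip //; exists h.
Qed.

(** * Projective dimension and depth *)

Section ProjectiveDimension.
Variable R : comNzRingType.

Lemma pdle_cover n (M : lmodType R) : pdle n M ->
  exists (P : lmodType R) (g : {linear P -> M}),
    projective P /\ forall x, exists v, g v = x.
Proof.
case: n => [|n] /= pM; first by exists M, idfun; split=> // x; exists x.
by case: pM => K [P [i [g [[_ gs _] pP _]]]]; exists P, g.
Qed.

(** A set of extended rationals need not have an infimum, but it does when it
    has a minimum. *)
Lemma ereal_inf_min (S : set (\bar rat)) (x : \bar rat) :
  S x -> (forall y, S y -> (x <= y)%E) -> ereal_inf S = x.
Proof.
move=> Sx xS; rewrite /ereal_inf /ereal_sup /supremum.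
have Sx' : (-%E @` S)%classic (- x)%E by exists x.
case: ifPn => [/eqP e|_]; first by move: Sx'; rewrite e.
rewrite (@xget_subset1 _ _ _ (- x)%E) ?oppeK //; last exact: is_subset1_supremums.
split=> [_ [y Sy <-]|z /(_ _ Sx') //].
by rewrite leeN2; apply: xS.
Qed.

Lemma pd_resolutions (M : lmodType R) n : has_projective_resolution M n ->
  ~ zero_module M ->
  exists2 k, has_projective_resolution M k & pd M = (k%:R)%:E.
Proof.
move=> Mn M0; rewrite /pd asboolF //.
have ex : exists k, `[< has_projective_resolution M k >].
  by exists n; apply/asboolP.
case: (ex_minnP ex) => k /asboolP Mk kmin; exists k => //.
apply: ereal_inf_min => [|_ [j Mj <-]]; first by exists k.
by rewrite lee_fin ler_nat kmin //; apply/asboolP.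
Qed.

Lemma pd_le_pdle (M : lmodType R) (q : rat) : 0 <= q -> (pd M <= q%:E)%E ->
  exists2 n, pdle n M & n%:R <= q.
Proof.
move=> q0 Mq; have [M0|M0] := pselect (zero_module M).
  by exists 0%N => //; exact: projective_zero.
have [[n Mn]|noM] := pselect (exists n, has_projective_resolution M n).
  have [k Mk pdk] := pd_resolutions Mn M0.
  by exists k; [exact: pdle_of_resolution|rewrite pdk lee_fin in Mq].
move: Mq; rewrite /pd asboolF // (_ : [set _ | _ in _]%classic = set0).
  by rewrite ereal_inf0.
by apply/seteqP; split=> // x [n Mn _]; apply: noM; exists n.
Qed.

Lemma pdle_pd_lt n (M : lmodType R) : pdle n M -> (pd M < +oo)%E.
Proof.
move=> /resolution_of_pdle Mn; have [M0|M0] := pselect (zero_module M).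
  by rewrite /pd asboolT.
by have [k _ ->] := pd_resolutions Mn M0; rewrite ltry.
Qed.

Lemma regular_sequence_nil : regular_sequence ([::] : seq R).
Proof.
split=> // -[c]; rewrite big_ord0 => /eqP.
by rewrite oner_eq0.
Qed.

(** When the lengths of regular sequences are unbounded the depth is 0 by
    convention, and the empty sequence attains it. *)
Lemma depth_attained (m : idealr R) : exists ys : seq R,
  [/\ {subset ys <= m}, regular_sequence ys & size ys = depth m].
Proof.
have nilP : exists ys : seq R,
    [/\ {subset ys <= m}, regular_sequence ys & size ys = 0%N].
  by exists [::]; split=> //; exact: regular_sequence_nil.
rewrite /depth /supremum; set A := (X in supremums X).
case: (A == set0) => //. case: xgetP => // d dE [ub lub]. 
have [[ys [ysm reg] <-]|nAd] := pselect (A d); first by exists ys.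
case: d ub lub nAd {dE} => [|d] ub lub nAd //.
suff /lub : ubound A d by rewrite Order.NatOrder.leEnat ltnn.
move=> j Aj; have := ub _ Aj; rewrite !Order.NatOrder.leEnat leq_eqVlt.
by case/orP=> // /eqP jd; rewrite jd in Aj.
Qed.

End ProjectiveDimension.

Theorem propositionA7 (R : comNzRingType) (m : idealr R)
    (noethR : noetherian R) (localR : is_local m)
    (M : lmodType R) (fgM : finitely_generated M)
    (lfM : locally_free_on_punctured_spectrum m M) :
  (pd M <= ((depth m)%:R / 2)%:E)%E -> (pd (tensor M M) < +oo)%E.
Proof.
move=> /pd_le_pdle[|n pM nd]; first by rewrite divr_ge0 // ler0n.
have [ys [ysm reg ysE]] := depth_attained m.
have [P [g [pP gs]]] := pdle_cover pM.
apply: (@pdle_pd_lt _ (n + n)); apply: (pdle_tensor reg _ pM pM).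
  move=> y /ysm ym.
  exact: (locally_free_split_by noethR fgM lfM pP gs ym).
by move: nd; rewrite ler_pdivlMr // -natrM ler_nat muln2 addnn ysE.
Qed.
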